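(* Let $Q_0$ be an acyclic quiver with $n$ mutable vertices $v_1,\dots,v_n$, let $t\in\mathbb{T}_n$, and let $Q_t$ be the mutable part of the quiver $\tilde Q_t$ in the mutation class of the framing $\widehat{Q_0}$. Then for each vertex $v$ of $Q_t$ the directed graph $L_v(Q_t)$ is acyclic. (In particular, it has no oriented $2$-cycles; $L_v(Q_t)$ is an acyclic quiver with some marked arrows.) Furthermore, the subquiver of $Q_t$ supported by all red vertices is acyclic, and the subquiver of $Q_t$ supported by all green vertices is acyclic.
   Context: A quiver is a finite directed graph with parallel edges (arrows) allowed and no oriented cycles of length 1 or 2; each vertex is marked mutable or frozen. Write $u\to v$ if there is at least one arrow from $u$ to $v$. Mutation $\mu_v(Q)$ at a mutable vertex $v$: (1) for each oriented path $u\to v\to w$ add a new arrow $u\to w$ (with multiplicity); (2) reverse all arrows incident to $v$; (3) remove oriented 2-cycles one at a time until none remain. The mutable part of a quiver is the induced subquiver on its mutable vertices. A quiver (or directed graph) is acyclic if it has no directed cycles. The framing $\widehat{Q_0}$ of a quiver $Q_0$ with mutable vertices $v_1,\dots,v_n$ is obtained by adding, for each $i$, a new frozen vertex $v_i'$ and a single arrow $v_i'\to v_i$. Let $\mathbb{T}_n$ be the $n$-regular tree with edges labeled by $1,\dots,n$ so that each label appears exactly once at each vertex, with a distinguished vertex $t_0$. Assign to each $t\in\mathbb{T}_n$ a quiver $\tilde Q_t$ so that $\tilde Q_{t_0}=\widehat{Q_0}$ and $\tilde Q_t=\mu_{v_i}(\tilde Q_{t'})$ whenever $t,t'$ are joined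 by an edge labeled $i$. Let $Q_t$ be the mutable part of $\tilde Q_t$, and let $c_{v_i'v_j;t}$ be the number of arrows $v_i'\to v_j$ minus the number of arrows $v_j\to v_i'$ in $\tilde Q_t$. A vertex $v_j$ of $Q_t$ is green if $c_{v_i'v_j;t}\ge 0$ for all $i$, and red if $c_{v_i'v_j;t}\le 0$ for all $i$. By a known theorem (sign coherence), every vertex is exactly one of green or red. For a vertex $v_j$ of $Q_t$, the directed graph $L_{v_j}(Q_t)$ is obtained from $Q_t$ as follows: (1) if $v_j$ is red (resp., green), then for each oriented 2-path $v_i\to v_j\to v_k$ in $Q_t$ with $v_i,v_k$ both green (resp., both red), add an arrow $v_k\to v_i$ labeled (marked) by $v_j$; (2) reverse all arrows that go from a red vertex to a green vertex. *)

(* Defs.v *)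
From HB Require Import structures.
From mathcomp Require Import all_boot all_order all_algebra.
From mathcomp Require Import zify.

Set Implicit Arguments.
Unset Strict Implicit.
Unset Printing Implicit Defensive.

Import Order.TTheory GRing.Theory Num.Theory.

(* A quiver on the finite vertex set V is given by its arrow multiplicities
   (number of arrows u -> w).  The boolean condition with u = w excludes loops,
   and with u != w it excludes oriented 2-cycles.  The marking of vertices as
   mutable or frozen is carried by an injective enumeration v : 'I_n -> V of
   the mutable vertices: the vertices outside its image are the frozen ones. *)
Definition no_short_cycles (V : finType) (a : {ffun V * V -> nat}) : bool :=
  [forall u, forall w, (a (u, w) == 0) || (a (w, u) == 0)].

Record quiver (V : finType) := Quiver {
  mult : {ffun V * V -> nat};
  multP : no_short_cycles mult
}.

Definition arr (V : finType) (Q : quiver V) (u w : V) : nat := mult Q (u, w).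

Definition edge (V : finType) (Q : quiver V) : rel V :=
  [rel u w | 0 < arr Q u w].

Definition acyclic (V : finType) (e : rel V) : Prop :=
  forall c : seq V, cycle e c -> c = [::].

Lemma arr_short (V : finType) (Q : quiver V) (u w : V) :
  arr Q u w = 0 \/ arr Q w u = 0.
Proof.
by have /forallP/(_ u)/forallP/(_ w)/orP[/eqP|/eqP] := multP Q; [left|right].
Qed.

Lemma quiver_ext (V : finType) (Q Q' : quiver V) : arr Q =2 arr Q' -> Q = Q'.
Proof.
case: Q Q' => [a Pa] [b Pb] eqab.
have {}eqab : a = b by apply/ffunP => -[u w]; apply: eqab.
by case: _ / eqab Pb => Pb; congr Quiver; apply: bool_irrelevance.
Qed.

Section Mutation.
Variables (V : finType) (v : V).

Definition add_paths (a : V -> V -> nat) (u w : V) : nat :=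
  a u w + a u v * a v w.

Definition reverse_at (a : V -> V -> nat) (u w : V) : nat :=
  if (u == v) || (w == v) then a w u else a u w.

(* Removing oriented 2-cycles one at a time until none remain leaves the
   truncated difference of the two multiplicities. *)
Definition cancel_2cycles (a : V -> V -> nat) (u w : V) : nat :=
  a u w - a w u.

Definition mutate_mult (Q : quiver V) : {ffun V * V -> nat} :=
  [ffun p => cancel_2cycles (reverse_at (add_paths (arr Q))) p.1 p.2].

Lemma mutate_multP (Q : quiver V) : no_short_cycles (mutate_mult Q).
Proof.
apply/forallP => u; apply/forallP => w; rewrite !ffunE /= /cancel_2cycles.
by rewrite !subn_eq0 leq_total.
Qed.

Definition mutate (Q : quiver V) : quiver V := Quiver (mutate_multP Q).

Lemma arr_mutate (Q : quiver V) (u w : V) :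
  arr (mutate Q) u w =
  if (u == v) || (w == v) then arr Q w u
  else (arr Q u w + arr Q u v * arr Q v w)
       - (arr Q w u + arr Q w v * arr Q v u).
Proof.
have loop : arr Q v v = 0 by case: (arr_short Q v v).
rewrite {1}/arr ffunE /= /cancel_2cycles /reverse_at /add_paths.
rewrite [(w == v) || _]orbC; case: ifP => // /orP[]/eqP->.
  by rewrite loop; case: (arr_short Q v w) => ->; lia.
by rewrite loop; case: (arr_short Q v u) => ->; lia.
Qed.

Lemma mutateK : involutive mutate.
Proof.
move=> Q; apply: quiver_ext => u w; rewrite !arr_mutate !eqxx !orbT /= orbC.
case: (w == v) => //=; case: (u == v) => //=.
rewrite [arr Q v u * _]mulnC [arr Q v w * _]mulnC.
by case: (arr_short Q u w); lia.
Qed.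

End Mutation.

(* inl u is an original vertex u; inr i is the new frozen vertex v_i'. *)
Section Framing.
Variables (n : nat) (V : finType) (v : 'I_n -> V).

Definition framing_mult (Q : quiver V) : {ffun (V + 'I_n) * (V + 'I_n) -> nat} :=
  [ffun p => match p with
             | (inl u, inl w) => arr Q u w
             | (inr i, inl w) => nat_of_bool (w == v i)
             | _ => 0
             end].

Lemma framing_multP (Q : quiver V) : no_short_cycles (framing_mult Q).
Proof.
apply/forallP => -[u|i]; apply/forallP => -[w|j]; rewrite !ffunE ?eqxx ?orbT //.
by case: (arr_short Q u w) => ->; rewrite eqxx ?orbT.
Qed.

Definition framing (Q : quiver V) : quiver (V + 'I_n)%type :=
  Quiver (framing_multP Q).

End Framing.

(* The vertices of the n-regular tree are the reduced words in the labels
   (no two consecutive letters equal); the empty word is t_0, and an edge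
   labeled i joins w and i :: w whenever both are reduced. *)
Definition tree (n : nat) := {w : seq 'I_n | sorted [rel i j | i != j] w}.

Definition tree_root (n : nat) : tree n := exist _ [::] isT.

Definition tree_edge (n : nat) (i : 'I_n) (t t' : tree n) : Prop :=
  val t = i :: val t' \/ val t' = i :: val t.

Definition mutation_assignment (n : nat) (V : finType) (v : 'I_n -> V)
    (Q0 : quiver V) (tQ : tree n -> quiver (V + 'I_n)%type) : Prop :=
  tQ (tree_root n) = framing v Q0 /\
  (forall (i : 'I_n) (t t' : tree n),
     tree_edge i t t' -> tQ t = mutate (inl (v i)) (tQ t')).

Lemma mutation_assignment_exists (n : nat) (V : finType) (v : 'I_n -> V)
    (Q0 : quiver V) : exists tQ, mutation_assignment v Q0 tQ.
Proof.
exists (fun t => foldr (fun i Q => mutate (inl (v i)) Q) (framing v Q0) (val t)).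
by split=> // i t t' [->|->] //=; rewrite mutateK.
Qed.

Section FramedQuiver.
Variables (n : nat) (V : finType) (v : 'I_n -> V) (tQ : quiver (V + 'I_n)%type).

(* The vertex v_j of the mutable part is represented by its index j. *)
Definition mutable_mult : {ffun 'I_n * 'I_n -> nat} :=
  [ffun p => arr tQ (inl (v p.1)) (inl (v p.2))].

Lemma mutable_multP : no_short_cycles mutable_mult.
Proof.
apply/forallP => i; apply/forallP => j; rewrite !ffunE /=.
by case: (arr_short tQ (inl (v i)) (inl (v j))) => ->; rewrite eqxx ?orbT.
Qed.

Definition mutable_part : quiver 'I_n := Quiver mutable_multP.

Definition cmx (i j : 'I_n) : int :=
  ((arr tQ (inr i) (inl (v j)))%:Z - (arr tQ (inl (v j)) (inr i))%:Z)%R.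

Definition green : pred 'I_n := [pred j | [forall i, (0 <= cmx i j)%R]].
Definition red : pred 'I_n := [pred j | [forall i, (cmx i j <= 0)%R]].

End FramedQuiver.

(* A directed graph with marked arrows: m k u w is the number of arrows u -> w
   that are unmarked (k = None) or marked by x (k = Some x). *)
Definition marked_digraph (V : finType) := option V -> V -> V -> nat.

Definition marked_edge (V : finType) (m : marked_digraph V) : rel V :=
  [rel u w | [exists k, 0 < m k u w]].

Section LGraph.
Variables (V : finType) (Q : quiver V) (green red : pred V) (v : V).

(* One arrow w -> u marked by v for each admissible 2-path u -> v -> w. *)
Definition L_step1 : marked_digraph V := fun k w u =>
  match k with
  | None => arr Q w u
  | Some x =>
      if (x == v) && ([&& red v, green u & green w] || [&& green v, red u & red w])
      then arr Q u v * arr Q v w else 0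
  end.

Definition reverse_red_green (m : marked_digraph V) : marked_digraph V :=
  fun k u w =>
    (if red u && green w then 0 else m k u w)
    + (if red w && green u then m k w u else 0).

Definition L_graph : marked_digraph V := reverse_red_green L_step1.

End LGraph.

Definition induced_edge (V : finType) (Q : quiver V) (A : pred V) : rel V :=
  [rel u w | [&& A u, A w & edge Q u w]].

(* Main.v *)
Require Import Defs.
From HB Require Import structures.
From mathcomp Require Import all_boot all_order all_algebra.
From mathcomp Require Import ring zify.

(** Why the theorem holds.

    Let H be the category of finite dimensional representations, over a field,
    of the opposite of the mutable part of Q0.  For representations X and Y
    the groups Hom(X, Y) and Ext(X, Y) are the kernel and the cokernel of one
    linear map between spaces of graded maps, so that dim Hom - dim Ext is the
    Euler form of the dimension vectors, and Ext is right exact.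

    The c-vectors of a seed are shown to be signed dimension vectors
    beta_j = +- dim X_j, where the X_j are exceptional (scalar endomorphisms,
    no self-extensions), Hom vanishes between distinct X_j of the same sign,
    Hom and Ext vanish from every positive X_j to every negative one, and the
    relation Ext(X_j, X_l) <> 0 between objects of the same sign is acyclic,
    as witnessed by an integer rank.  This is the record [config]: up to
    shifting the negative objects, it is a two-term simple-minded collection.
    The exchange matrix is recovered as the antisymmetrized Euler form of the
    beta_j.  Since dimension vectors are nonnegative and nonzero, sign
    coherence is built in: green means positive and red means negative.

    The heart of the proof is that such configurations can be mutated.  At a
    positive object M, a positive P with Ext(P, M) <> 0 is replaced by its
    universal extension by copies of M ([universal_extension]).  A negative N
    with Hom(N, M) <> 0 is replaced by the cone of the universal map
    N -> M^a; this cone is a single signed representation because the map is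
    injective (then its cokernel is a positive object) or surjective (then its
    kernel is a negative one), by the argument of Happel and Ringel in
    [detecting_mono_or_epi].  All vanishing conditions for the new objects
    follow from the six-term exact sequences; the linear combinations of
    dimension vectors are those of the mutation rule for c-vectors.  Mutation
    at a negative object is the dual statement, obtained by transposing
    representations, which exchanges the two signs.

    Acyclicity inside one colour is the rank condition, since an arrow from
    j to l between vertices of one colour means Ext(X_l, X_j) <> 0.  For the
    graph L_k with k green, an added red arrow from l to j comes from
    Hom(X_l, X_k) <> 0 and Ext(X_j, X_k) <> 0.  If X_l -> X_k is surjective,
    right exactness gives Ext(X_j, X_l) <> 0, so that l already precedes j; if
    it is injective, Ext(X_l, -) vanishes on the other red objects, so that no
    red arrow ends at l.  Either way the red arrows, old and added, can be
    ranked ([two_path_rank]). *)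

Set Implicit Arguments.
Unset Strict Implicit.
Unset Printing Implicit Defensive.

Import Order.TTheory GRing.Theory Num.Theory.

(** * Kernels and cokernels of linear maps in commutative squares *)

Section KernelCokernelDimension.
Local Open Scope ring_scope.
Variables (K : fieldType) (U V U' V' : vectType K).
Variables (D : 'Hom(U, V)) (D' : 'Hom(U', V')).

Lemma lker_codim_limg :
  (\dim (lker D) + dim V = (dim V - \dim (limg D)) + dim U)%N.
Proof.
have := limg_ker_dim D fullv; have := dimvS (subvf (limg D)).
by rewrite capfv !dimvf; lia.
Qed.

Lemma dim_lker_le (phi : {linear U -> U'}) :
    (forall u, D u = 0 -> D' (phi u) = 0) ->
    (forall u, D u = 0 -> phi u = 0 -> u = 0) ->
  (\dim (lker D) <= \dim (lker D'))%N.
Proof.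
move=> phi_ker phi_inj; rewrite -(@limg_dim_eq _ _ _ (linfun phi) (lker D)).
  apply/dimvS/subvP => _ /memv_imgP[u uD ->]; rewrite memv_ker in uD.
  by rewrite memv_ker lfunE /= phi_ker //; apply/eqP.
apply/eqP; rewrite -subv0; apply/subvP => u /memv_capP[].
by rewrite !memv_ker lfunE => /eqP/phi_inj + /eqP H => /(_ H) ->; rewrite mem0v.
Qed.

Lemma codim_limg_le (psi : {linear V -> V'}) :
    (forall u, exists u', psi (D u) = D' u') -> (forall w, exists v, psi v = w) ->
  (dim V' - \dim (limg D') <= dim V - \dim (limg D))%N.
Proof.
move=> psi_img psi_surj; pose f := linfun psi.
have f_full : (f @: fullv = fullv)%VS.
  apply/eqP; rewrite eqEsubv subvf; apply/subvP => w _.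
  by have [v <-] := psi_surj w; rewrite -[psi v]lfunE memv_img ?memvf.
have f_img : (f @: limg D <= limg D')%VS.
  apply/subvP => _ /memv_imgP[_ /memv_imgP[u _ ->] ->].
  by have [u' fu] := psi_img u; rewrite lfunE /= fu memv_img ?memvf.
have := limg_ker_dim f fullv; have := limg_ker_dim f (limg D).
rewrite f_full !dimvf capfv; have := dimvS f_img.
by have := dimvS (capvSr (limg D) (lker f)); lia.
Qed.

(** Left exactness of kernels, as an inequality: an element of [lker D] which
    [phi] kills is the image under [chi] of an element of [lker E]. *)
Lemma dim_lker_exact (W Z : vectType K) (E : 'Hom(W, Z))
    (phi : {linear U -> U'}) (chi : {linear W -> U}) :
    (forall u, D u = 0 -> D' (phi u) = 0) ->
    (forall u, D u = 0 -> phi u = 0 -> exists2 w, E w = 0 & chi w = u) ->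
  (\dim (lker D) <= \dim (lker D') + \dim (lker E))%N.
Proof.
move=> phi_ker ex; rewrite -(limg_ker_dim (linfun phi)) addnC leq_add //.
  apply/dimvS/subvP => _ /memv_imgP[u uD ->]; rewrite memv_ker in uD.
  by rewrite memv_ker lfunE /= phi_ker //; apply/eqP.
rewrite -[leqRHS](limg_ker_dim (linfun chi)).
apply: leq_trans (leq_addl _ _); apply/dimvS/subvP => u /memv_capP[].
rewrite !memv_ker lfunE => /eqP/ex + /eqP H => /(_ H)[w /eqP Ew <-].
by rewrite -[chi w]lfunE memv_img ?memv_ker.
Qed.

End KernelCokernelDimension.

(** * Graded linear maps *)

Section GradedMaps.
Local Open Scope ring_scope.
Variables (K : fieldType) (J : finType).
Implicit Types x y z : J -> nat.

(** Families of matrices whose sizes depend on the index, stored as functions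
    on the finite type of all matrix positions: this makes the space of such
    families a finite dimensional vector space. *)
Notation gmap x y := {ffun {j : J & ('I_(x j) * 'I_(y j))%type} -> K^o}.

Definition blk x y (F : gmap x y) (j : J) : 'M[K]_(x j, y j) :=
  \matrix_(a, b) F (Tagged (fun j => ('I_(x j) * 'I_(y j))%type) (a, b)).

Definition of_blk x y (f : forall j, 'M[K]_(x j, y j)) : gmap x y :=
  [ffun p => f (tag p) (tagged p).1 (tagged p).2].

Lemma of_blkE x y (f : forall j, 'M[K]_(x j, y j)) j : blk (of_blk f) j = f j.
Proof. by apply/matrixP => a b; rewrite mxE ffunE. Qed.

Lemma blk_inj x y (F G : gmap x y) :
  (forall j, blk F j = blk G j) -> F = G.
Proof.
move=> eqFG; apply/ffunP => -[j [a b]].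
by have /matrixP/(_ a b) := eqFG j; rewrite !mxE.
Qed.

Lemma blk_linear x y c (F G : gmap x y) j :
  blk (c *: F + G) j = c *: blk F j + blk G j.
Proof. by apply/matrixP => a b; rewrite !mxE !ffunE. Qed.

Lemma blk0 x y j : blk (0 : gmap x y) j = 0.
Proof. by apply/matrixP => a b; rewrite !mxE ffunE. Qed.

Lemma dim_gmap x y : dim (gmap x y : vectType K) = (\sum_j x j * y j)%N.
Proof.
have -> : dim (gmap x y : vectType K) =
  (#|{: {j : J & ('I_(x j) * 'I_(y j))%type}}| * 1)%N by [].
rewrite muln1 card_tagged sumnE big_map big_enum.
by apply: eq_bigr => j _; rewrite card_prod !card_ord.
Qed.

Definition gpre x y z (P : forall j, 'M[K]_(x j, y j)) (F : gmap y z) :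
  gmap x z := of_blk (fun j => P j *m blk F j).

Lemma gpre_linear x y z P : linear (@gpre x y z P).
Proof.
move=> c F G; apply: blk_inj => j.
by rewrite blk_linear !of_blkE blk_linear mulmxDr -scalemxAr.
Qed.
HB.instance Definition _ x y z P :=
  GRing.isLinear.Build _ _ _ _ (@gpre x y z P) (gpre_linear P).

Definition gtr x y (F : gmap x y) : gmap y x := of_blk (fun j => (blk F j)^T).

Lemma gtr_linear x y : linear (@gtr x y).
Proof.
move=> c F G; apply: blk_inj => j.
by rewrite blk_linear !of_blkE blk_linear linearD linearZ.
Qed.
HB.instance Definition _ x y :=
  GRing.isLinear.Build _ _ _ _ (@gtr x y) (@gtr_linear x y).

Lemma gtrK x y (F : gmap x y) : gtr (gtr F) = F.
Proof. by apply: blk_inj => j; rewrite !of_blkE trmxK. Qed.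

End GradedMaps.

Notation gmap K x y :=
  {ffun {j : _ & ('I_(x j) * 'I_(y j))%type} -> (GRing.regular K)}.

(** * Representations of a quiver, their Hom and Ext *)

Section Representations.
Local Open Scope ring_scope.
Variables (K : fieldType) (I Ar : finType).

(** A representation of the quiver with vertices [I] and arrows [Ar] from
    [s a] to [t a].  Matrices act on row vectors.  The arrow maps are stored as
    a graded map, whose equality is pointwise, so that a representation is
    equal to its double dual and not merely isomorphic to it. *)
Record rep (s t : Ar -> I) := Rep {
  rdim : I -> nat;
  rstr : gmap K (fun a => rdim (s a)) (fun a => rdim (t a))
}.

Definition act s t (X : rep s t) (a : Ar) :
  'M[K]_(rdim X (s a), rdim X (t a)) := blk (rstr X) a.

Definition is_hom s t (X Y : rep s t)
    (f : forall i, 'M[K]_(rdim X i, rdim Y i)) : Prop :=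
  forall a, act X a *m f (t a) = f (s a) *m act Y a.

(** The differential of the two-term complex whose cohomology is Hom and Ext. *)
Definition cobound s t (X Y : rep s t) (F : gmap K (rdim X) (rdim Y)) :
    gmap K (fun a => rdim X (s a)) (fun a => rdim Y (t a)) :=
  of_blk (fun a => act X a *m blk F (t a) - blk F (s a) *m act Y a).

Lemma cobound_linear s t (X Y : rep s t) : linear (@cobound s t X Y).
Proof.
move=> c F G; apply: blk_inj => a; rewrite blk_linear !of_blkE !blk_linear.
by rewrite mulmxDr mulmxDl -scalemxAr -scalemxAl scalerBr opprD addrACA.
Qed.
HB.instance Definition _ s t X Y :=
  GRing.isLinear.Build _ _ _ _ (@cobound s t X Y) (@cobound_linear s t X Y).

Definition cobound_map s t (X Y : rep s t) := linfun (@cobound s t X Y).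

Definition hom s t (X Y : rep s t) : nat := \dim (lker (cobound_map X Y)).

Definition ext s t (X Y : rep s t) : nat :=
  dim (gmap K (fun a => rdim X (s a)) (fun a => rdim Y (t a)) : vectType K)
  - \dim (limg (cobound_map X Y)).

Definition euler (s t : Ar -> I) (x y : I -> nat) : int :=
  (\sum_i x i * y i)%N%:Z - (\sum_a x (s a) * y (t a))%N%:Z.

Lemma hom_ext_euler s t (X Y : rep s t) :
  (hom X Y)%:Z - (ext X Y)%:Z = euler s t (rdim X) (rdim Y).
Proof.
have := lker_codim_limg (cobound_map X Y); rewrite -/(hom X Y) -/(ext X Y).
by rewrite !dim_gmap /euler; lia.
Qed.

Lemma is_homP s t (X Y : rep s t) (F : gmap K (rdim X) (rdim Y)) :
  cobound_map X Y F = 0 <-> is_hom (blk F).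
Proof.
rewrite lfunE /=; split=> [F0 a|homF].
  have := congr1 (fun G => blk G a) F0; rewrite of_blkE blk0 => /eqP.
  by rewrite subr_eq0 => /eqP.
by apply: blk_inj => a; rewrite of_blkE blk0 homF subrr.
Qed.

Lemma is_hom_of_blk s t (X Y : rep s t) (f : forall i, 'M[K]_(rdim X i, rdim Y i)) :
  is_hom f -> cobound_map X Y (of_blk f) = 0.
Proof. by move=> hf; apply/is_homP => a; rewrite !of_blkE. Qed.

Lemma is_hom_comp s t (X Y Z : rep s t) f g :
  @is_hom s t X Y f -> @is_hom s t Y Z g -> is_hom (fun i => f i *m g i).
Proof. by move=> hf hg a; rewrite mulmxA hf -mulmxA hg mulmxA. Qed.

Lemma hom_eq0 s t (X Y : rep s t) f i :
  hom X Y = 0%N -> @is_hom s t X Y f -> f i = 0.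
Proof.
move=> /eqP + /is_hom_of_blk/eqP; rewrite dimv_eq0 -memv_ker => /eqP->.
by rewrite memv0 => /eqP f0; rewrite -[f i]of_blkE f0 blk0.
Qed.

Lemma hom_eq0I s t (X Y : rep s t) :
  (forall f, @is_hom s t X Y f -> forall i, f i = 0) -> hom X Y = 0%N.
Proof.
move=> f0; apply/eqP; rewrite dimv_eq0 -subv0; apply/subvP => F.
rewrite memv_ker memv0 => /eqP/is_homP/f0 F0.
by apply/eqP/blk_inj => i; rewrite F0 blk0.
Qed.

Lemma ext_eq0 s t (X Y : rep s t)
    (g : forall a, 'M[K]_(rdim X (s a), rdim Y (t a))) : ext X Y = 0%N ->
  exists h : forall i, 'M[K]_(rdim X i, rdim Y i),
    forall a, act X a *m h (t a) - h (s a) *m act Y a = g a.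
Proof.
move=> ext0; have full : (limg (cobound_map X Y) == fullv)%VS.
  by rewrite eqEdim subvf dimvf -subn_eq0; apply/eqP.
have /memv_imgP[F _ gF] : of_blk g \in limg (cobound_map X Y).
  by rewrite (eqP full) memvf.
exists (blk F) => a; rewrite -[g a]of_blkE gF lfunE /=.
by rewrite of_blkE.
Qed.

(** A cocycle which is not a coboundary: it defines a non-split extension. *)
Lemma ext_neq0 s t (X Y : rep s t) : (0 < ext X Y)%N ->
  exists g : forall a, 'M[K]_(rdim X (s a), rdim Y (t a)),
    forall h : forall i, 'M[K]_(rdim X i, rdim Y i),
    ~ forall a, act X a *m h (t a) - h (s a) *m act Y a = g a.
Proof.
rewrite subn_gt0 -dimvf => ltd.
have /subvPn[G _ Gn] : ~~ (fullv <= limg (cobound_map X Y))%VS.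
  by apply: contraL ltd => /dimvS; rewrite -leqNgt.
exists (blk G) => h hG; case/negP: Gn; suff -> : G = cobound_map X Y (of_blk h).
  by rewrite memv_img ?memvf.
by rewrite lfunE; apply: blk_inj => a; rewrite !of_blkE hG.
Qed.

(** Transposition gives a representation of the opposite quiver; it reverses
    Hom and Ext, which halves the work below. *)
Definition dual s t (X : rep s t) : rep t s := @Rep t s (rdim X) (gtr (rstr X)).

Lemma dualK s t (X : rep s t) : dual (dual X) = X.
Proof. by case: X => d X; rewrite /dual /= gtrK. Qed.

Lemma act_dual s t (X : rep s t) a : act (dual X) a = (act X a)^T.
Proof. by rewrite /act of_blkE. Qed.

Lemma is_hom_dual s t (X Y : rep s t) f :
  @is_hom s t X Y f -> @is_hom t s (dual Y) (dual X) (fun i => (f i)^T).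
Proof. by move=> hf a; rewrite !act_dual -!trmx_mul hf. Qed.

Lemma hom_dual s t (X Y : rep s t) : hom (dual Y) (dual X) = hom X Y.
Proof.
have le s' t' (X' Y' : rep s' t') : (hom X' Y' <= hom (dual Y') (dual X'))%N.
  apply: (dim_lker_le (phi := @gtr K I (rdim X') (rdim Y'))) => F.
    by move/is_homP/is_hom_dual/is_hom_of_blk.
  by move=> _ /(congr1 (@gtr K I (rdim Y') (rdim X'))); rewrite gtrK linear0.
by apply/eqP; rewrite eqn_leq le andbT -{2}(dualK X) -{2}(dualK Y) le.
Qed.

Lemma euler_dual s t x y : euler t s x y = euler s t y x.
Proof.
by congr (_%:Z - _%:Z); apply: eq_bigr => i _; rewrite mulnC.
Qed.

Lemma ext_dual s t (X Y : rep s t) : ext (dual Y) (dual X) = ext X Y.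
Proof.
have := hom_ext_euler X Y; have := hom_ext_euler (dual Y) (dual X).
by rewrite euler_dual hom_dual /=; lia.
Qed.

End Representations.

(** * Short exact sequences *)

Section ShortExactSequences.
Local Open Scope ring_scope.
Variables (K : fieldType) (I Ar : finType).

Lemma hom_epi (s t : Ar -> I) (B C Y : rep K s t) p :
  @is_hom _ _ _ s t B C p -> (forall i, row_full (p i)) ->
  (hom C Y <= hom B Y)%N.
Proof.
move=> hp fp; apply: (dim_lker_le (phi := @gpre K I _ _ (rdim Y) p)) => F.
  by move/is_homP => hF; apply: is_hom_of_blk; apply: is_hom_comp hp hF.
move=> _ F0; apply: blk_inj => i; apply: (row_full_inj (fp i)).
by rewrite blk0 mulmx0 -(blk0 K (rdim B) (rdim Y) i) -F0 of_blkE.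
Qed.

(** Right exactness of Ext: graded maps extend along an injection. *)
Lemma ext_mono (s t : Ar -> I) (A B Y : rep K s t) f :
  @is_hom _ _ _ s t A B f -> (forall i, row_free (f i)) ->
  (ext A Y <= ext B Y)%N.
Proof.
move=> hf ff; apply: (codim_limg_le (psi := @gpre K Ar
  (fun a => rdim A (s a)) (fun a => rdim B (s a)) (fun a => rdim Y (t a))
  (fun a => f (s a)))) => [F|G].
  exists (of_blk (fun i => f i *m blk F i)); rewrite !lfunE.
  apply: blk_inj => a; rewrite !of_blkE mulmxBr !mulmxA.
  by rewrite hf.
exists (of_blk (fun a => pinvmx (f (s a)) *m blk G a)).
by apply: blk_inj => a; rewrite !of_blkE mulmxA mulmxVp ?mul1mx.
Qed.

(** Exactness in the middle is encoded by the zero composite together with the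
    additivity of dimensions. *)
Definition ses (s t : Ar -> I) (A B C : rep K s t) : Prop :=
  exists f p,
    [/\ @is_hom _ _ _ s t A B f, @is_hom _ _ _ s t B C p,
        forall i, row_free (f i), forall i, row_full (p i) &
        forall i, f i *m p i = 0 /\ rdim B i = (rdim A i + rdim C i)%N].

Lemma exact_factor a b c d (f : 'M[K]_(a, b)) (p : 'M_(b, c)) (g : 'M_(b, d)) :
    row_free f -> row_full p -> f *m p = 0 -> b = (a + c)%N -> f *m g = 0 ->
  g = p *m (pinvmx p *m g).
Proof.
move=> ff fp fp0 b_ac fg0.
have kp : (kermx p <= f)%MS.
  have sub : (f <= kermx p)%MS by apply/sub_kermxP.
  rewrite -(geq_leqif (mxrank_leqif_sup sub)) mxrank_ker (eqP ff) (eqP fp) b_ac.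
  by rewrite addnK.
have /submxP[D eD] : (1%:M - p *m pinvmx p <= f)%MS.
  apply: submx_trans kp; apply/sub_kermxP.
  by rewrite mulmxBl mul1mx -mulmxA mulVpmx // mulmx1 subrr.
apply/eqP; rewrite mulmxA -subr_eq0 -{1}[g]mul1mx -mulmxBl eD -mulmxA fg0.
by rewrite mulmx0.
Qed.

Lemma hom_exact (s t : Ar -> I) (A B C Y : rep K s t) :
  ses A B C -> (hom B Y <= hom A Y + hom C Y)%N.
Proof.
move=> [f [p [hf hp ff fp fp0]]].
apply: (dim_lker_exact (phi := @gpre K I _ _ (rdim Y) f)
   (chi := @gpre K I _ _ (rdim Y) p)) => F.
  by move/is_homP => hF; apply: is_hom_of_blk; apply: is_hom_comp hf hF.
move=> /is_homP hF F0.
have fF0 i : f i *m blk F i = 0.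
  by rewrite -(blk0 K (rdim A) (rdim Y) i) -F0 of_blkE.
pose g i := pinvmx (p i) *m blk F i.
have gF i : p i *m g i = blk F i.
  by have [z d] := fp0 i; rewrite -(exact_factor (ff i) (fp i) z d (fF0 i)).
exists (of_blk g); last by apply: blk_inj => i; rewrite !of_blkE.
apply: is_hom_of_blk => a; apply: (row_full_inj (fp (s a))).
by rewrite mulmxA -hp -mulmxA gF hF -gF mulmxA.
Qed.

Lemma euler_hom_ext_ses (s t : Ar -> I) (A B C Y : rep K s t) : ses A B C ->
  (hom B Y)%:Z - (ext B Y)%:Z =
  (hom A Y)%:Z - (ext A Y)%:Z + ((hom C Y)%:Z - (ext C Y)%:Z).
Proof.
move=> [f [p [_ _ _ _ d]]]; rewrite !hom_ext_euler /euler.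
have e1 : (\sum_i rdim B i * rdim Y i =
    \sum_i rdim A i * rdim Y i + \sum_i rdim C i * rdim Y i)%N.
  rewrite -big_split; apply: eq_bigr => i _.
  by have [_ ->] := d i; rewrite mulnDl.
have e2 : (\sum_a rdim B (s a) * rdim Y (t a) =
   \sum_a rdim A (s a) * rdim Y (t a) + \sum_a rdim C (s a) * rdim Y (t a))%N.
  rewrite -big_split; apply: eq_bigr => a _.
  by have [_ ->] := d (s a); rewrite mulnDl.
by rewrite e1 e2; lia.
Qed.

(** The numerical shadow of a six-term exact sequence
    0 -> C0 -> B0 -> A0 -> C1 -> B1 -> free -> 0: every term is at most the sum
    of its neighbours, and the alternating sum of all terms vanishes. *)
Record six_term (a0 b0 c0 a1 b1 c1 : nat) : Prop := SixTerm {
  six_c0 : (c0 <= b0)%N; six_b0 : (b0 <= a0 + c0)%N;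
  six_a0 : (a0 <= b0 + c1)%N; six_c1 : (c1 <= b1 + a0)%N;
  six_b1 : (b1 <= a1 + c1)%N; six_a1 : (a1 <= b1)%N;
  six_euler : (a0 + c0 + b1 = b0 + a1 + c1)%N }.

(** The connecting map is not constructed: the two inequalities around it
    follow from the other four and from the additivity of the Euler form. *)
Lemma ses_contra (s t : Ar -> I) (A B C Y : rep K s t) : ses A B C ->
  six_term (hom A Y) (hom B Y) (hom C Y) (ext A Y) (ext B Y) (ext C Y).
Proof.
move=> S; have := euler_hom_ext_ses Y S; have := hom_exact Y S.
case: S => f [p [hf hp ff fp _]].
by have := hom_epi Y hp fp; have := ext_mono Y hf ff; split; lia.
Qed.

Lemma row_full_tr m n (A : 'M[K]_(m, n)) : row_full A^T = row_free A.
Proof. by rewrite /row_full /row_free mxrank_tr. Qed.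

Lemma row_free_tr m n (A : 'M[K]_(m, n)) : row_free A^T = row_full A.
Proof. by rewrite /row_full /row_free mxrank_tr. Qed.

Lemma ses_dual (s t : Ar -> I) (A B C : rep K s t) :
  ses A B C -> ses (dual C) (dual B) (dual A).
Proof.
move=> [f [p [hf hp ff fp d]]]; exists (fun i => (p i)^T), (fun i => (f i)^T).
split; [exact: is_hom_dual | exact: is_hom_dual | | | ] => i.
- by rewrite row_free_tr fp.
- by rewrite row_full_tr ff.
- by have [fp0 di] := d i; split; [rewrite -trmx_mul fp0 trmx0 | rewrite addnC].
Qed.

Lemma ses_co (s t : Ar -> I) (A B C Y : rep K s t) : ses A B C ->
  six_term (hom Y C) (hom Y B) (hom Y A) (ext Y C) (ext Y B) (ext Y A).
Proof.
by move/ses_dual/(ses_contra (dual Y)); rewrite !hom_dual !ext_dual.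
Qed.

Lemma ext_epi (s t : Ar -> I) (B C Y : rep K s t) p :
  @is_hom _ _ _ s t B C p -> (forall i, row_full (p i)) ->
  (ext Y C <= ext Y B)%N.
Proof.
move=> /is_hom_dual hp fp; rewrite -!(ext_dual Y).
by apply: ext_mono hp _ => i; rewrite row_free_tr fp.
Qed.

Lemma coker_ses (s t : Ar -> I) (A B : rep K s t) f :
    @is_hom _ _ _ s t A B f -> (forall i, row_free (f i)) ->
  exists C p, [/\ ses A B C, @is_hom _ _ _ s t B C p, forall i, row_full (p i) &
    forall i, f i *m p i = 0].
Proof.
move=> hf ff.
pose p i : 'M[K]_(rdim B i, \rank (cokermx (f i))) := col_base (cokermx (f i)).
have fp i : row_full (p i) by exact: col_base_full.
have fp0 i : f i *m p i = 0.
  have := mulmx_coker (f i); rewrite -{1}(mulmx_base (cokermx (f i))) mulmxA.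
  move=> e; have := row_base_free (cokermx (f i)) => /row_freeP[D eD].
  by rewrite -[LHS]mulmx1 -eD mulmxA e mul0mx.
have d i : rdim B i = (rdim A i + \rank (cokermx (f i)))%N.
  by rewrite mxrank_coker (eqP (ff i)) subnKC // -(eqP (ff i)) rank_leq_col.
pose C := @Rep K I Ar s t (fun i => \rank (cokermx (f i)))
  (of_blk (fun a => pinvmx (p (s a)) *m (act B a *m p (t a)))).
have hp : @is_hom _ _ _ s t B C p.
  move=> a; rewrite /act /= of_blkE.
  apply: (exact_factor (ff _) (fp _) (fp0 _) (d _)).
  by rewrite mulmxA -hf -mulmxA fp0 mulmx0.
exists C, p; split => //; exists f, p; split => // i; split => //; exact: d.
Qed.

Lemma ker_ses (s t : Ar -> I) (B C : rep K s t) p :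
    @is_hom _ _ _ s t B C p -> (forall i, row_full (p i)) ->
  exists A, ses A B C.
Proof.
move=> /is_hom_dual hp fp; have [i|C' [q [S _ _ _]]] := coker_ses hp.
  by rewrite row_free_tr fp.
by exists (dual C'); rewrite -(dualK B) -(dualK C); apply: ses_dual.
Qed.

Lemma coker_hom_eq0 (s t : Ar -> I) (B C Y : rep K s t) p :
    @is_hom _ _ _ s t B C p -> (forall i, row_full (p i)) ->
    (forall g, @is_hom _ _ _ s t C Y g -> forall i, p i *m g i = 0) ->
  hom C Y = 0%N.
Proof.
move=> hp fp g0; apply: hom_eq0I => g hg i; apply: (row_full_inj (fp i)).
by rewrite mulmx0 g0.
Qed.

(** The extension of [C] by [A] with cocycle [g]; with [g = 0] it is the direct
    sum. *)
Definition extension (s t : Ar -> I) (C A : rep K s t)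
    (g : forall a, 'M[K]_(rdim C (s a), rdim A (t a))) : rep K s t :=
  @Rep K I Ar s t (fun i => rdim C i + rdim A i)%N
    (of_blk (fun a => block_mx (act C a) (g a) 0 (act A a))).

Lemma act_extension (s t : Ar -> I) (C A : rep K s t) g a :
  act (@extension s t C A g) a = block_mx (act C a) (g a) 0 (act A a).
Proof. by rewrite /act of_blkE. Qed.

Lemma extension_ses (s t : Ar -> I) (C A : rep K s t) g :
  ses A (@extension s t C A g) C.
Proof.
exists (fun i => row_mx 0 1%:M), (fun i => col_mx 1%:M 0); split.
- move=> a; rewrite act_extension mul_mx_row mulmx0 mulmx1.
  by rewrite mul_row_block !mul0mx !mul1mx !add0r.
- move=> a; rewrite act_extension mul_block_col mul_col_mx.
  by rewrite !mulmx1 !mulmx0 mul1mx mul0mx !addr0.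
- move=> i; apply/row_freeP; exists (col_mx 0 1%:M).
  by rewrite mul_row_col mul0mx mul1mx add0r.
- move=> i; apply/row_fullP; exists (row_mx 1%:M 0).
  by rewrite mul_row_col mul0mx mul1mx addr0.
- by move=> i; rewrite mul_row_col mul0mx mul1mx addr0 addnC.
Qed.

Lemma hom_extension (s t : Ar -> I) (C A Y : rep K s t) g u w :
  @is_hom _ _ _ s t (@extension s t C A g) Y (fun i => col_mx (u i) (w i)) <->
  @is_hom _ _ _ s t A Y w /\
  forall a, act C a *m u (t a) + g a *m w (t a) = u (s a) *m act Y a.
Proof.
rewrite /is_hom; split=> [h|[hA hC] a].
  split=> a; have := h a; rewrite act_extension mul_block_col mul_col_mx mul0mx;
  by rewrite add0r => /eq_col_mx[].
by rewrite act_extension mul_block_col mul_col_mx mul0mx add0r hA hC.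
Qed.

End ShortExactSequences.

(** * Exceptional representations and universal maps *)

Section Exceptional.
Local Open Scope ring_scope.
Variables (K : fieldType) (I Ar : finType) (s t : Ar -> I).
Implicit Types M N P Y : rep K s t.

Definition exceptional M : Prop := hom M M = 1%N /\ ext M M = 0%N.

Lemma brick_scalar M f : hom M M = 1%N -> is_hom (X := M) (Y := M) f ->
  exists c, forall i, f i = c%:M.
Proof.
move=> hM hf; pose e := of_blk (fun i => 1%:M : 'M[K]_(rdim M i, rdim M i)).
have e_ker : (<[e]> <= lker (cobound_map M M))%VS.
  rewrite -memvE memv_ker; apply/eqP/is_hom_of_blk => a.
  by rewrite mulmx1 mul1mx.
have e_neq0 : e != 0.
  apply: contra_eq_neq hM => e0; rewrite (_ : hom M M = 0%N) //.
  apply: hom_eq0I => g _ i; rewrite -[g i]mul1mx.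
  have -> : 1%:M = blk e i by rewrite of_blkE.
  by rewrite e0 blk0 mul0mx.
have e_full : (<[e]> == lker (cobound_map M M))%VS.
  by rewrite eqEdim e_ker dim_vline e_neq0 -/(hom M M) hM.
have : of_blk f \in lker (cobound_map M M).
  by rewrite memv_ker is_hom_of_blk.
rewrite -(eqP e_full) => /vlineP[c fe]; exists c => i.
rewrite -[f i]of_blkE fe -[_ *: _]addr0 blk_linear blk0 addr0 of_blkE.
by rewrite scalemx1.
Qed.

(** A map from the extension to [M] restricts to a scalar on the subobject
    [M]; a nonzero scalar would split the extension, and a zero one would give
    a map from [P] to [M]. *)
Lemma nonsplit_extension M P :
    hom M M = 1%N -> hom P M = 0%N -> (0 < ext P M)%N ->
  exists2 P', ses M P' P & hom P' M = 0%N.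
Proof.
move=> hM hPM /ext_neq0[g gP]; exists (@extension K I Ar s t P M g).
  exact: extension_ses.
apply: hom_eq0I => f hf i.
have fE j : f j = col_mx (usubmx (f j)) (dsubmx (f j)) by rewrite vsubmxK.
have {hf} : is_hom (X := @extension K I Ar s t P M g) (Y := M)
    (fun j => col_mx (usubmx (f j)) (dsubmx (f j))).
  by move=> a; rewrite !vsubmxK; exact: hf.
case/hom_extension => /(brick_scalar hM)[c fc] hu.
have c0 : c = 0.
  apply/eqP/negPn/negP => c_neq0.
  case: (gP (fun j => - c^-1 *: usubmx (f j))) => a.
  rewrite -scalemxAr -scalemxAl -scalerBr -hu fc mul_mx_scalar opprD addNKr scalerN.
  by rewrite scaleNr opprK scalerA mulVf // scale1r.
have hu' : is_hom (X := P) (Y := M) (fun j => usubmx (f j)).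
  by move=> a; rewrite -hu fc c0 -scalemx1 scale0r mulmx0 addr0.
by rewrite fE fc c0 (hom_eq0 i hPM hu') -scalemx1 scale0r col_mx0.
Qed.

Definition rep0 : rep K s t := @Rep K I Ar s t (fun _ => 0%N) 0.

Lemma euler0l y : euler s t (fun _ => 0%N) y = 0.
Proof. by rewrite /euler !big1. Qed.

Lemma hom0rep Y : hom rep0 Y = 0%N /\ ext rep0 Y = 0%N.
Proof.
have h0 : hom rep0 Y = 0%N.
  by apply: hom_eq0I => f _ i; apply/matrixP => -[].
by have := hom_ext_euler rep0 Y; rewrite h0 euler0l; lia.
Qed.

Lemma homrep0 Y : hom Y rep0 = 0%N /\ ext Y rep0 = 0%N.
Proof.
have h0 : hom Y rep0 = 0%N.
  by apply: hom_eq0I => f _ i; apply/matrixP => a -[].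
have := hom_ext_euler Y rep0; rewrite h0 -euler_dual.
by rewrite /euler !big1 //; lia.
Qed.

Fixpoint rpower M r : rep K s t :=
  if r is r'.+1 then @extension K I Ar s t (rpower M r') M (fun _ => 0) else rep0.

Lemma rdim_rpower M r i : rdim (rpower M r) i = (r * rdim M i)%N.
Proof. by elim: r => //= r ->; rewrite mulSn addnC. Qed.

Lemma rpower_ses M r : ses M (rpower M r.+1) (rpower M r).
Proof. exact: extension_ses. Qed.

Lemma rpower_contra M r Y :
  (hom (rpower M r) Y <= r * hom M Y)%N /\ (ext (rpower M r) Y <= r * ext M Y)%N.
Proof.
elim: r => [|r IHr]; first by have [-> ->] := hom0rep Y.
by case: (ses_contra Y (rpower_ses M r)); nia.
Qed.

Lemma rpower_co M r Y :
  (hom Y (rpower M r) <= r * hom Y M)%N /\ (ext Y (rpower M r) <= r * ext Y M)%N.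
Proof.
elim: r => [|r IHr]; first by have [-> ->] := homrep0 Y.
by case: (ses_co Y (rpower_ses M r)); nia.
Qed.

Lemma rpower_last M r :
  is_hom (X := rpower M r.+1) (Y := M) (fun i => col_mx 0 1%:M).
Proof.
apply/hom_extension; split=> a; first by rewrite mulmx1 mul1mx.
by rewrite mulmx0 !mul0mx addr0.
Qed.

Lemma is_hom_row M r N f g :
  is_hom (X := N) (Y := rpower M r.+1) (fun i => row_mx (f i) (g i)) <->
  is_hom (X := N) (Y := rpower M r) f /\ is_hom (X := N) (Y := M) g.
Proof.
rewrite /is_hom; split=> [h|[hf hg] a].
  split=> a; have := h a; rewrite act_extension mul_row_block mul_mx_row;
  by rewrite !mulmx0 addr0 add0r => /eq_row_mx[].
rewrite act_extension mul_row_block mul_mx_row !mulmx0 addr0 add0r.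
by rewrite hf hg.
Qed.

(** Precomposition with [f] is injective on Hom(T, M). *)
Definition detects N T M (f : forall i, 'M[K]_(rdim N i, rdim T i)) : Prop :=
  forall g, is_hom (X := T) (Y := M) g -> (forall i, f i *m g i = 0) ->
  forall i, g i = 0.

Lemma detects_rpower N T M f r :
  @detects N T M f -> @detects N T (rpower M r) f.
Proof.
move=> df; elim: r => [|r IHr] g hg fg0 i; first by apply/matrixP => a [].
have gE j : g j = row_mx (lsubmx (g j)) (rsubmx (g j)) by rewrite hsubmxK.
have {hg} : is_hom (X := T) (Y := rpower M r.+1)
    (fun j => row_mx (lsubmx (g j)) (rsubmx (g j))).
  by move=> a; rewrite !hsubmxK; exact: hg.
have fgE j : f j *m lsubmx (g j) = 0 /\ f j *m rsubmx (g j) = 0.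
  have /eqP := fg0 j; rewrite {1}gE mul_mx_row row_mx_eq0.
  by case/andP => /eqP ? /eqP.
case/is_hom_row => /IHr H1 /df H2.
rewrite gE H1 ?H2 ?row_mx0 // => j; by case: (fgE j).
Qed.

(** The map N -> M^r built from [r] linearly independent maps N -> M.  As long
    as [r] is smaller than [hom N M], the maps that factor through M^r do not
    exhaust Hom(N, M), and any other one can be added as a new component. *)
Lemma detecting_map M N r : exceptional M -> (r <= hom N M)%N ->
  exists2 f, is_hom (X := N) (Y := rpower M r) f & detects M f.
Proof.
move=> [hM eM]; elim: r => [_|r IHr ltr].
  exists (fun i => 0) => [a|g _ _ i]; last by apply/matrixP => -[].
  by rewrite mulmx0 mul0mx.
have [f hf df] := IHr (ltnW ltr).
pose pf := linfun (@gpre K I _ _ (rdim M) f).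
have /subvPn[H H_ker H_im] :
    ~~ (lker (cobound_map N M) <= pf @: lker (cobound_map (rpower M r) M))%VS.
  apply: contraL ltr => /dimvS; rewrite -/(hom N M) -leqNgt => /leq_trans; apply.
  rewrite -[leqRHS]muln1 -hM; have [le_r _] := rpower_contra M r M.
  apply: leq_trans le_r; rewrite -/(hom _ _).
  by rewrite -[hom _ _](limg_ker_dim pf) leq_addl.
have hH : is_hom (X := N) (Y := M) (blk H).
  by apply/is_homP; apply/eqP; rewrite -memv_ker.
exists (fun i => row_mx (f i) (blk H i)); first exact/is_hom_row.
move=> g hg fg0 i.
have gE j : g j = col_mx (usubmx (g j)) (dsubmx (g j)) by rewrite vsubmxK.
have {hg} : is_hom (X := rpower M r.+1) (Y := M)
    (fun j => col_mx (usubmx (g j)) (dsubmx (g j))).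
  by move=> a; rewrite !vsubmxK; exact: hg.
case/hom_extension => /(brick_scalar hM)[c gc] hu.
have {}hu : is_hom (X := rpower M r) (Y := M) (fun j => usubmx (g j)).
  by move=> a; rewrite -hu mul0mx addr0.
have fgE j : f j *m usubmx (g j) + c *: blk H j = 0.
  by rewrite -(fg0 j) gE mul_row_col gc mul_mx_scalar col_mxKu.
have c0 : c = 0.
  apply/eqP/negPn/negP => c_neq0; case/negP: H_im.
  pose G := of_blk (fun j => - c^-1 *: usubmx (g j)).
  have -> : H = pf G.
    rewrite lfunE; apply: blk_inj => j; rewrite !of_blkE -scalemxAr.
    have /eqP := fgE j; rewrite addr_eq0 => /eqP ->.
    by rewrite scalerN scaleNr opprK scalerA mulVf // scale1r.
  rewrite memv_img // memv_ker is_hom_of_blk // => a.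
  by rewrite -scalemxAr -scalemxAl hu.
have u0 := df _ hu; rewrite gE gc c0 u0 => [|j].
  by rewrite -scalemx1 scale0r col_mx0.
by have := fgE j; rewrite c0 scale0r addr0.
Qed.

(** The lemma of Happel and Ringel.  Let [e] be a graded projection of [T] with
    kernel the image of [f]; its coboundary takes values in the image of [f],
    so it is [e z f] for some cochain [z].  As Ext(T, N) = 0, [e z] is the
    coboundary of some [h], and then [f h] is an endomorphism of [N], hence a
    scalar [c], and [h f - e] is an endomorphism of [T].  If [c] is nonzero,
    [f] is injective.  If [c = 0], then [f (h f - e) = 0], whence [h f = e]:
    the identity, being the sum of [e] and a map through [f], factors through
    [f], which is therefore surjective. *)
Lemma detecting_mono_or_epi N T f :
    hom N N = 1%N -> ext T N = 0%N -> is_hom (X := N) (Y := T) f ->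
    detects T f ->
  (forall i, row_free (f i)) \/ (forall i, row_full (f i)).
Proof.
move=> hN eTN hf df.
pose y i := pinvmx (f i); pose e i : 'M[K]_(rdim T i) := 1%:M - y i *m f i.
have fe i : f i *m e i = 0.
  by rewrite mulmxBr mulmx1 mulmxA mulmxKpV ?subrr ?submx_refl.
have eE i : e i = 1%:M - y i *m f i by [].
clearbody e; clearbody y.
pose z a := y (s a) *m act N a - act T a *m y (t a).
have zf a : z a *m f (t a) = act T a *m e (t a) - e (s a) *m act T a.
  rewrite !eE mulmxBl -!mulmxA hf mulmxBr mulmxBl mulmx1 mul1mx !mulmxA.
  by rewrite [RHS]addrC opprB addrA subrK.
have [h hE] := ext_eq0 (fun a => e (s a) *m z a) eTN.
have hfh : is_hom (X := N) (Y := N) (fun i => f i *m h i).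
  move=> a; rewrite mulmxA hf -!mulmxA; apply/eqP; rewrite -subr_eq0 -mulmxBr.
  by rewrite hE mulmxA fe mul0mx.
have [c fhc] := brick_scalar hN hfh.
have hk : is_hom (X := T) (Y := T) (fun i => h i *m f i - e i).
  move=> a; have := congr1 (mulmx^~ (f (t a))) (hE a).
  rewrite /= mulmxBl -!mulmxA hf zf mulmxBr !mulmxA.
  have -> : e (s a) *m act T a *m e (t a) = act T a *m e (t a).
    rewrite {1}eE 2!mulmxBl mul1mx -!mulmxA [f _ *m (_ *m _)]mulmxA -hf.
    by rewrite -(mulmxA (act N a)) fe !mulmx0 subr0.
  have -> : e (s a) *m e (s a) = e (s a).
    by rewrite {1}eE mulmxBl mul1mx -mulmxA fe mulmx0 subr0.
  move=> /(canRL (subrK _)) E; rewrite mulmxBr mulmxBl !mulmxA E.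
  by rewrite -addrA addrC addrA subrK.
case: (eqVneq c 0) => [c0|c_neq0].
  right=> i; apply/row_fullP; exists (h i + y i).
  have := df _ hk _ i; rewrite mulmxDl => k0.
  have /eqP : h i *m f i - e i = 0.
    apply: k0 => j; rewrite mulmxBr fe subr0 mulmxA fhc c0.
    by rewrite -scalemx1 scale0r mul0mx.
  rewrite subr_eq0 => /eqP ->.
  by rewrite eE subrK.
left=> i; apply/row_freeP; exists (c^-1 *: h i).
by rewrite -scalemxAr fhc scale_scalar_mx mulVf.
Qed.

Lemma rpower_euler M r Y :
  (hom (rpower M r) Y + r * ext M Y = ext (rpower M r) Y + r * hom M Y)%N.
Proof.
elim: r => [|r IHr]; first by have [-> ->] := hom0rep Y.
by case: (ses_contra Y (rpower_ses M r)); nia.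
Qed.

(** What is used of the universal extension 0 -> M^a -> P' -> P -> 0, where
    [a = ext P M]: the bounds are those of its six-term sequences. *)
Definition uext M P P' : Prop :=
  [/\ hom P' M = 0%N /\ ext P' M = 0%N,
    forall i, rdim P' i = (rdim P i + ext P M * rdim M i)%N,
    forall Y, (hom P' Y <= hom P Y + ext P M * hom M Y)%N /\
              (ext P' Y <= ext P Y + ext P M * ext M Y)%N &
    forall Y, (hom Y P' <= hom Y P + ext P M * hom Y M)%N /\
              (ext Y P' <= ext Y P + ext P M * ext Y M)%N].

(** Each non-split extension by [M] lowers [ext P M] by one, so [ext P M] of
    them in succession kill it. *)
Lemma universal_extension M P :
  exceptional M -> hom P M = 0%N -> exists P', uext M P P'.
Proof.
move=> [hM eM]; move e_a: (ext P M) => a; rewrite /uext.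
elim: a P e_a => [|a IHa] P eP hP.
  by exists P; rewrite eP; split=> // [i|Y|Y]; rewrite ?mul0n ?addn0.
have [|P1 S hP1] := nonsplit_extension hM hP; first by rewrite eP.
have eP1 : ext P1 M = a by case: (ses_contra M S); rewrite hM eM hP1 hP eP; lia.
have [P' [hP' dP' contra co]] := IHa P1 eP1 hP1.
have [f [p [_ _ _ _ d]]] := S.
exists P'; rewrite eP; rewrite eP1 in dP' contra co; split=> // [i|Y|Y].
- by rewrite dP'; have [_ ->] := d i; lia.
- by have := contra Y; case: (ses_contra Y S); nia.
- by have := co Y; case: (ses_co Y S); nia.
Qed.

(** What is used of the cokernel of an injective universal map N -> M^a, where
    [a = hom N M]. *)
Definition ucoker M N C : Prop :=
  [/\ hom C M = 0%N /\ ext C M = 0%N,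
    forall i, (rdim C i + rdim N i)%N = (hom N M * rdim M i)%N,
    forall Y, [/\ hom C Y <= hom N M * hom M Y,
                  ext C Y <= hom N M * ext M Y + hom N Y &
                  ext N Y <= hom N M * ext M Y]%N &
    forall Y, (hom Y C <= hom N M * hom Y M + ext Y N)%N /\
              (ext Y C <= hom N M * ext Y M)%N].

(** What is used of the kernel of a surjective universal map N -> M^a, where
    [a = hom N M]; for [a = 0] this is [N] itself. *)
Definition uker M N L : Prop :=
  [/\ hom L M = 0%N,
    forall i, (rdim L i + hom N M * rdim M i)%N = rdim N i,
    forall Y, (hom L Y <= hom N Y + hom N M * ext M Y)%N /\
              (ext L Y <= ext N Y)%N,
    forall Y, (hom Y L <= hom Y N)%N /\
              (ext Y L <= ext Y N + hom N M * hom Y M)%N &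
    (0 < hom N M)%N -> forall Y, (ext Y M <= ext Y N)%N].

Lemma universal_cone M N :
    exceptional M -> exceptional N -> hom M N = 0%N -> ext M N = 0%N ->
  (exists C, ucoker M N C) \/ (exists L, uker M N L).
Proof.
move=> [hM eM] [hN eN] hMN eMN.
have [f hf df] := detecting_map (conj hM eM) (leqnn (hom N M)).
move: hf df; set T := rpower M _ => hf df.
have [hTM eTM] := rpower_contra M (hom N M) M.
have TM := rpower_euler M (hom N M) M.
rewrite -/T hM eM in hTM eTM TM.
have eTN : ext T N = 0%N.
  by have [_] := rpower_contra M (hom N M) N; rewrite -/T eMN; lia.
case: (detecting_mono_or_epi hN eTN hf (detects_rpower df)) => fm; [left|right].
- have [C [p [S hp fp fp0]]] := coker_ses hf fm; exists C.
  have hCM : hom C M = 0%N.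
    apply: (coker_hom_eq0 hp fp) => g hg; apply: df (is_hom_comp hp hg) _ => i.
    by rewrite mulmxA fp0 mul0mx.
  split=> [|i|Y|Y].
  + by split=> //; case: (ses_contra M S); lia.
  + have [f' [p' [_ _ _ _ d]]] := S; have [_] := d i.
    by rewrite rdim_rpower; lia.
  + have := rpower_contra M (hom N M) Y; rewrite -/T.
    by case: (ses_contra Y S); split; lia.
  + have := rpower_co M (hom N M) Y; rewrite -/T.
    by case: (ses_co Y S); split; lia.
- have [L S] := ker_ses hf fm; exists L.
  split=> [|i|Y|Y|].
  + by case: (ses_contra M S); lia.
  + have [f' [p' [_ _ _ _ d]]] := S; have [_] := d i.
    by rewrite rdim_rpower; lia.
  + have := rpower_contra M (hom N M) Y; rewrite -/T.
    by case: (ses_contra Y S); split; lia.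
  + have := rpower_co M (hom N M) Y; rewrite -/T.
    by case: (ses_co Y S); split; lia.
  (* M is a quotient of M^a, hence of N *)
  + move=> a_gt0 Y; move: f hf fm {df S hTM eTM TM eTN}; rewrite /T -(prednK a_gt0).
    move=> f hf fm; apply: leq_trans (ext_epi Y hf fm).
    apply: ext_epi (rpower_last M _) _ => i; apply/row_fullP.
    by exists (row_mx 0 1%:M); rewrite mul_row_col mul0mx mul1mx add0r.
Qed.

End Exceptional.

(** * Configurations of signed exceptional representations *)

Section Configurations.
Local Open Scope ring_scope.
Variables (K : fieldType) (I Ar J : finType).

Definition signed (b : bool) (d : nat) : int := if b then d%:Z else - d%:Z.

(** The antisymmetrized Euler form E(x, y) - E(y, x), in which the vertex terms
    cancel. *)
Definition skew_euler (s t : Ar -> I) (x y : I -> int) : int :=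
  \sum_a (x (t a) * y (s a) - x (s a) * y (t a)).

Lemma skew_euler_signed (s t : Ar -> I) (X Y : rep K s t) b c :
  skew_euler s t (fun i => signed b (rdim X i)) (fun i => signed c (rdim Y i)) =
  (if b == c then 1 else -1) *
  (((hom X Y)%:Z - (ext X Y)%:Z) - ((hom Y X)%:Z - (ext Y X)%:Z)).
Proof.
rewrite !hom_ext_euler /euler.
have -> : (\sum_i rdim Y i * rdim X i = \sum_i rdim X i * rdim Y i)%N.
  by apply: eq_bigr => i _; rewrite mulnC.
rewrite opprB addrC addrA subrK !(big_morph Posz PoszD (erefl _)) -sumrB.
rewrite mulr_sumr; apply: eq_bigr => a _.
by rewrite /signed; case: b c => -[] /=; rewrite !PoszM; ring.
Qed.

(** Bilinearity of the Euler form, with all terms moved to the side where they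
    are positive. *)
Lemma euler_additive_l (s t : Ar -> I) (X Y Z W : rep K s t) (a b : nat) :
    (forall i, rdim Z i + a * rdim Y i = rdim X i + b * rdim W i)%N ->
  forall V, (hom Z V + a * hom Y V + ext X V + b * ext W V =
             ext Z V + a * ext Y V + hom X V + b * hom W V)%N.
Proof.
move=> d V.
have e0 : (\sum_i rdim Z i * rdim V i + a * (\sum_i rdim Y i * rdim V i) =
   \sum_i rdim X i * rdim V i + b * (\sum_i rdim W i * rdim V i))%N.
  rewrite !big_distrr -!big_split; apply: eq_bigr => i _ /=.
  by rewrite !mulnA -!mulnDl d.
have e1 : (\sum_i rdim Z (s i) * rdim V (t i) +
      a * (\sum_i rdim Y (s i) * rdim V (t i)) =
    \sum_i rdim X (s i) * rdim V (t i) +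
      b * (\sum_i rdim W (s i) * rdim V (t i)))%N.
  rewrite !big_distrr -!big_split; apply: eq_bigr => i _ /=.
  by rewrite !mulnA -!mulnDl d.
have := hom_ext_euler Z V; have := hom_ext_euler Y V.
have := hom_ext_euler X V; have := hom_ext_euler W V.
rewrite /euler; move: e0 e1.
move: (\sum_i rdim Z i * _)%N (\sum_i rdim Y i * _)%N
  (\sum_i rdim X i * _)%N (\sum_i rdim W i * _)%N => z y x w.
move: (\sum_a rdim Z (s a) * _)%N (\sum_a rdim Y (s a) * _)%N
  (\sum_a rdim X (s a) * _)%N (\sum_a rdim W (s a) * _)%N => z' y' x' w'.
nia.
Qed.

Lemma euler_additive_r (s t : Ar -> I) (X Y Z W : rep K s t) (a b : nat) :
    (forall i, rdim Z i + a * rdim Y i = rdim X i + b * rdim W i)%N ->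
  forall V, (hom V Z + a * hom V Y + ext V X + b * ext V W =
             ext V Z + a * ext V Y + hom V X + b * hom V W)%N.
Proof.
move=> d V; rewrite -!(hom_dual V) -!(ext_dual V).
exact: (@euler_additive_l t s (dual X) (dual Y) (dual Z) (dual W)).
Qed.

(** The categorical data behind a seed.  With the negative objects shifted by
    one this is a two-term simple-minded collection; the conditions listed are
    those on which its mutation rests.  The rank is an integer so that
    duality can negate it. *)
Record config (s t : Ar -> I) (X : J -> rep K s t) (pos : J -> bool)
    (rk : J -> int) : Prop := Config {
  config_exc : forall j, exceptional (X j);
  config_hom : forall j l, j != l -> pos j = pos l -> hom (X j) (X l) = 0%N;
  config_perp : forall j l, pos j -> ~~ pos l ->
    hom (X j) (X l) = 0%N /\ ext (X j) (X l) = 0%N;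
  config_rk : forall j l, j != l -> pos j = pos l ->
    (0 < ext (X j) (X l))%N -> rk l < rk j }.

Lemma config_dual (s t : Ar -> I) X pos rk :
  @config s t X pos rk ->
  config (fun j => dual (X j)) (fun j => ~~ pos j) (fun j => - rk j).
Proof.
move=> [exc orth perp ord].
split=> [j|j l ne /(can_inj negbK) eq|j l|j l ne /(can_inj negbK) eq].
- by rewrite /exceptional hom_dual ext_dual; exact: exc.
- by rewrite hom_dual orth // eq_sym.
- by rewrite negbK hom_dual ext_dual => nj pl; exact: perp.
- by rewrite ext_dual ltrN2 => /ord -> //; rewrite eq_sym.
Qed.

Lemma threshold (rk : J -> int) (A B : pred J) :
    (forall a b, A a -> B b -> rk a < rk b) ->
  exists theta : int,
    (forall a, A a -> rk a < theta) /\ (forall b, B b -> theta <= rk b).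
Proof.
move=> AB; case: (pickP B) => [b0 Bb0|B0].
  case: (Order.TotalTheory.arg_minP rk Bb0) => b Bb bmin.
  by exists (rk b); split=> // a Aa; apply: AB.
exists (1 + \sum_j `|rk j|); split=> [a _|b]; last by rewrite B0.
rewrite (bigD1 a) //= addrA ltr_wpDr ?sumr_ge0 // ltz1D.
exact: ler_norm.
Qed.

Section Mutation.
Variables (s t : Ar -> I) (X : J -> rep K s t) (pos : J -> bool) (rk : J -> int).
Variable k : J.

(** The object replacing [X j], and its sign, after mutation at the positive
    object [X k].  [X k] itself survives as a negative object. *)
Inductive mutated (j : J) : rep K s t -> bool -> Prop :=
| MutatedSelf of j = k : mutated j (X k) false
| MutatedUext Y of j != k & pos j & uext (X k) (X j) Y : mutated j Y true
| MutatedUcoker Y of j != k & ~~ pos j & ucoker (X k) (X j) Y : mutated j Y true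
| MutatedUker Y of j != k & ~~ pos j & uker (X k) (X j) Y : mutated j Y false.

Hypotheses (cfg : config X pos rk) (pos_k : pos k).

Lemma mutated_exists j : exists Yb, mutated j Yb.1 Yb.2.
Proof.
have [exc orth perp ord] := cfg.
case: (eqVneq j k) => [->|ne]; first by exists (X k, false); exact: MutatedSelf.
case pj: (pos j).
  have [|Y HY] := @universal_extension _ _ _ s t (X k) (X j) (exc k).
    by apply: orth; rewrite // pj.
  by exists (Y, true); apply: MutatedUext.
have [h e] := perp k j pos_k (negbT pj).
case: (universal_cone (exc k) (exc j) h e) => -[Y HY].
  by exists (Y, true); apply: MutatedUcoker; rewrite ?pj.
by exists (Y, false); apply: MutatedUker; rewrite ?pj.
Qed.

(** Right exactness: a surjection from [X j] to [X k] maps Ext(X_j, X_j) = 0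
    onto Ext(X_j, X_k), and an injection into a power of [X k] restricts a
    vanishing Ext onto it. *)
Lemma hom_or_ext j : ~~ pos j -> (0 < hom (X j) (X k))%N -> ext (X j) (X k) = 0%N.
Proof.
have [exc orth perp ord] := cfg => nj a_gt0.
have [hk ek] := exc k; have [hj ej] := exc j.
have [h e] := perp k j pos_k nj.
case: (universal_cone (exc k) (exc j) h e) => -[Y].
  by case=> _ _ /(_ (X k))[_ _]; rewrite ek; lia.
by case=> _ _ _ _ /(_ a_gt0 (X j)); lia.
Qed.

Variables (X' : J -> rep K s t) (pos' : J -> bool).
Hypothesis mut : forall j, mutated j (X' j) (pos' j).

(** In each case the six-term sequences bound [hom] by 1 and [ext] by 0, while
    the Euler form takes the value 1. *)
Lemma mutated_exceptional j : exceptional (X' j).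
Proof.
have [exc orth perp ord] := cfg; have [hk ek] := exc k; have [hj ej] := exc j.
case: (mut j) => [_|Y ne pj|Y ne nj|Y ne nj] //.
- move=> [[hYk eYk] dY contra co].
  have hkj : hom (X k) (X j) = 0%N by apply: orth; rewrite 1?eq_sym // pj.
  have ekj : (ext (X j) (X k) * ext (X k) (X j))%N = 0%N.
    case: (posnP (ext (X j) (X k))) => [-> //|a_gt0].
    case: (posnP (ext (X k) (X j))) => [->|b_gt0]; first by rewrite muln0.
    have r1 : rk k < rk j by apply: ord a_gt0; rewrite // pj.
    suff : rk j < rk k by rewrite ltNge (ltW r1).
    by apply: ord b_gt0; rewrite 1?eq_sym // pj.
  have d i : (rdim Y i + 0 * rdim Y i =
      rdim (X j) i + ext (X j) (X k) * rdim (X k) i)%N.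
    by rewrite dY addn0.
  have := euler_additive_l d (X j); have := euler_additive_r d Y.
  have := contra Y; have := contra (X j); have := co Y.
  rewrite hYk eYk hj ej hkj !muln0 ekj !mul0n !addn0 => c1 c2 c3 E1 E2.
  by split; lia.
- move=> [[hYk eYk] dY contra co].
  have [hkj ekj] := perp k j pos_k nj.
  have d i : (rdim Y i + 1 * rdim (X j) i =
      rdim (rep0 K s t) i + hom (X j) (X k) * rdim (X k) i)%N.
    by rewrite mul1n dY.
  have := euler_additive_l d (X j); have := euler_additive_r d Y.
  have [c1 c2 c3] := contra (X j); have [c4 c5 _] := contra Y.
  have [h1 h2] := hom0rep (X j); have [h3 h4] := homrep0 Y.
  have := co Y; move: c1 c2 c3 c4 c5; rewrite h1 h2 h3 h4.
  rewrite hYk eYk hj ej hkj ekj !muln0 !mul1n ?addn0 ?add0n.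
  by move=> c1 c2 c3 c4 c5 c6 E1 E2; split; lia.
- move=> [hYk dY contra co _].
  have [hkj ekj] := perp k j pos_k nj.
  have d i : (rdim Y i + hom (X j) (X k) * rdim (X k) i =
      rdim (X j) i + 0 * rdim (X k) i)%N.
    by rewrite dY addn0.
  have := euler_additive_l d (X j); have := euler_additive_r d Y.
  have := contra Y; have := contra (X j); have := co Y; have := contra (X k).
  have e0 : (hom (X j) (X k) * ext (X j) (X k))%N = 0%N.
    case: (posnP (hom (X j) (X k))) => [-> //|a_gt0].
    by rewrite hom_or_ext ?muln0.
  rewrite hYk hj ej hkj ekj ek !muln0 !mul0n !addn0 => c1 c2 c3 c4 E1 E2.
  by split; nia.
Qed.

Lemma mutated_hom j l :
  j != l -> pos' j = pos' l -> hom (X' j) (X' l) = 0%N.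
Proof.
have [exc orth perp ord] := cfg; have [hk ek] := exc k.
have perp_k i : ~~ pos i -> hom (X k) (X i) = 0%N /\ ext (X k) (X i) = 0%N.
  exact: perp.
case: (mut j) => [->|Y nj pj|Y nj pj|Y nj pj];
  case: (mut l) => [->|Z nl pl|Z nl pl|Z nl pl] //; rewrite ?eqxx //.
- move=> [_ _ _ co _] _ _; have [h0 e0] := perp_k l pl.
  by have := co (X k); lia.
- move=> [_ _ _ coZ] [[hYk _] _ contraY _] ne _.
  have h0 : hom (X j) (X l) = 0%N by apply: orth; rewrite // pj pl.
  have h1 : hom (X k) (X l) = 0%N by apply: orth; rewrite 1?eq_sym // pos_k pl.
  by have := coZ Y; have := contraY (X l); rewrite hYk h0 h1; lia.
- move=> [_ _ _ coZ] [[hYk _] _ contraY _] ne _.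
  have [h0 e0] := perp j l pj pl; have [h1 e1] := perp_k l pl.
  by have := coZ Y; have := contraY (X l); rewrite hYk e0 e1; lia.
- move=> [_ _ _ coZ] [[hYk _] _ contraY _] ne _.
  have h1 : hom (X k) (X l) = 0%N by apply: orth; rewrite 1?eq_sym // pos_k pl.
  by have := coZ Y; case: (contraY (X l)); rewrite hYk h1; lia.
- move=> [_ _ _ coZ] [[hYk _] _ contraY _] ne _.
  have [h1 e1] := perp_k l pl.
  have h0 : hom (X j) (X l) = 0%N.
    by apply: orth; rewrite // (negbTE pj) (negbTE pl).
  by have := coZ Y; case: (contraY (X l)); rewrite hYk h0 e1; lia.
- by case.
- move=> [_ _ _ coZ _] [_ _ contraY _ _] ne _.
  have [h1 e1] := perp_k l pl.
  have h0 : hom (X j) (X l) = 0%N.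
    by apply: orth; rewrite // (negbTE pj) (negbTE pl).
  by have := coZ Y; have := contraY (X l); rewrite h0 e1; lia.
Qed.

Lemma mutated_perp j l : pos' j -> ~~ pos' l ->
  hom (X' j) (X' l) = 0%N /\ ext (X' j) (X' l) = 0%N.
Proof.
have [exc orth perp ord] := cfg; have [hk ek] := exc k.
have perp_k i : ~~ pos i -> hom (X k) (X i) = 0%N /\ ext (X k) (X i) = 0%N.
  exact: perp.
move=> pj' npl'; have ne : j != l by apply: contraNneq npl' => <-.
case: (mut j) pj' => [_|Y nj pj HY|Y nj pj HY|Y nj pj HY] // _;
  case: (mut l) npl' => [_|Z nl pl HZ|Z nl pl HZ|Z nl pl HZ] // _.
- by case: HY.
- have [[hYk _] _ contraY _] := HY; have [_ _ _ coZ _] := HZ.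
  have [h0 e0] := perp j l pj pl; have [h1 e1] := perp_k l pl.
  by have := coZ Y; have := contraY (X l); rewrite hYk h0 e0 h1 e1; lia.
- by case: HY.
- have [[hYk _] _ contraY _] := HY; have [_ _ _ coZ _] := HZ.
  have [h1 e1] := perp_k l pl.
  have h0 : hom (X j) (X l) = 0%N.
    by apply: orth; rewrite // (negbTE pj) (negbTE pl).
  by have := coZ Y; case: (contraY (X l)); rewrite hYk h0 h1 e1; lia.
Qed.

(** The positive objects have no extensions by the new cokernels, which go on
    top.  Among the negative objects the new one, [X k], has to be placed above
    the kernels and below the objects with an extension by [X k]; this is
    possible because a surjection from [X a] to [X k] and a nonzero element of
    Ext(X_b, X_k) together force Ext(X_b, X_a) <> 0, so that [a] was already below
    [b]. *)
Lemma mutated_rank : exists rk' : J -> int,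
  forall j l, j != l -> pos' j = pos' l ->
    (0 < ext (X' j) (X' l))%N -> rk' l < rk' j.
Proof.
have [exc orth perp ord] := cfg; have [hk ek] := exc k.
have [|theta [lo hi]] := @threshold rk
  [pred j | [&& ~~ pos j, ~~ pos' j & (0 < hom (X j) (X k))%N]]
  [pred j | ~~ pos j && (0 < ext (X j) (X k))%N].
  move=> a b /= /and3P[na]; case: (mut a) => [ak|Y _ pa|Y _ _|Y _ _ HY] //.
    by rewrite ak pos_k in na.
  move=> _ a_gt0 /andP[nb b_gt0]; have [_ _ _ _ /(_ a_gt0 (X b)) le_ba] := HY.
  apply: ord; last exact: leq_trans b_gt0 le_ba.
    by apply: contraTneq b_gt0 => ->; rewrite hom_or_ext.
  by rewrite (negbTE na) (negbTE nb).
have [//|top [lt_top _]] := @threshold rk predT pred0.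
(* doubling the old ranks makes room for X k at the threshold *)
pose rk' j := if pos' j then (if pos j then rk j else top)
  else if j == k then 2 * theta else 2 * rk j + 1.
exists rk' => j l; rewrite /rk'; move: (mut j) (mut l).
move Ej: (pos' j) => bj; move El: (pos' l) => bl.
move=> mj; case: mj Ej => [->|Y nj pj HY|Y nj pj HY|Y nj pj HY] Ej ml;
  case: ml El => [->|Z nl pl HZ|Z nl pl HZ|Z nl pl HZ] El ne //;
  rewrite ?eqxx // in ne * => _.
- have [_ _ _ coZ _] := HZ; have := coZ (X k).
  have [h1 e1] := perp k l pos_k pl; rewrite e1 hk (negbTE nl) => le gt.
  have : rk l < theta.
    by apply: lo; rewrite /= pl El /=; move: le gt; clear; lia.
  lia.
- have [_ _ _ coZ] := HZ; have [[_ eYk] _ contraY _] := HY.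
  rewrite pj pl => gt.
  have : (0 < ext (X j) (X l) + ext (X j) (X k) * ext (X k) (X l))%N.
    by have := coZ Y; have := contraY (X l); rewrite eYk; lia.
  rewrite addn_gt0 muln_gt0 => /orP[|/andP[jk kl]].
    by apply: ord; rewrite // pj pl.
  apply: (@lt_trans _ _ (rk k)); [apply: ord kl|apply: ord jk] => //.
  + by rewrite eq_sym.
  + by rewrite pos_k pl.
  + by rewrite pos_k pj.
- have [_ _ _ coZ] := HZ; have [[_ eYk] _ _ _] := HY.
  by have := coZ Y; rewrite eYk; lia.
- by rewrite (negbTE pj) pl lt_top.
- have [_ _ _ coZ] := HZ; have [[_ eYk] _ _ _] := HY.
  by have := coZ Y; rewrite eYk; lia.
- have [_ _ contraY _ _] := HY; have := contraY (X k).
  rewrite (negbTE nj) => le gt; have : theta <= rk j.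
    by apply: hi; rewrite /= pj /=; move: le gt; clear; lia.
  lia.
- have [_ _ _ coZ _] := HZ; have [hYk _ contraY _ _] := HY.
  rewrite (negbTE nj) (negbTE nl) => gt.
  suff : rk l < rk j by lia.
  apply: ord => //; first by rewrite (negbTE pj) (negbTE pl).
  by have := coZ Y; have := contraY (X l); rewrite hYk; lia.
Qed.

Lemma mutated_config : exists rk', config X' pos' rk'.
Proof.
have [rk' ord'] := mutated_rank; exists rk'; split=> //.
- exact: mutated_exceptional.
- exact: mutated_hom.
- exact: mutated_perp.
Qed.

End Mutation.

Definition signed_dim (s t : Ar -> I) (X : J -> rep K s t) (pos : J -> bool)
    (j : J) (i : I) : int :=
  signed (pos j) (rdim (X j) i).

Section Signs.
Variables (s t : Ar -> I) (X : J -> rep K s t) (pos : J -> bool) (rk : J -> int).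
Hypothesis cfg : config X pos rk.
Local Notation beta := (signed_dim X pos).

Lemma skew_same_sign j l : j != l -> pos j = pos l ->
  skew_euler s t (beta j) (beta l) = (ext (X l) (X j))%:Z - (ext (X j) (X l))%:Z.
Proof.
move=> ne e; have [_ orth _ _] := cfg; rewrite skew_euler_signed e eqxx.
by rewrite !orth // 1?eq_sym //; lia.
Qed.

Lemma ext_antisym j l : j != l -> pos j = pos l ->
  (0 < ext (X j) (X l))%N -> ext (X l) (X j) = 0%N.
Proof.
move=> ne e gt; have [_ _ _ ord] := cfg; have lt := ord _ _ ne e gt.
case: (posnP (ext (X l) (X j))) => // gt'.
have : rk j < rk l by apply: ord gt'; rewrite // eq_sym.
by rewrite ltNge (ltW lt).
Qed.

Lemma skew_opposite_sign k j : pos k -> ~~ pos j ->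
  skew_euler s t (beta k) (beta j) = (hom (X j) (X k))%:Z - (ext (X j) (X k))%:Z.
Proof.
move=> pk nj; have [_ _ perp _] := cfg; have [h e] := perp k j pk nj.
by rewrite skew_euler_signed h e pk (negbTE nj) /=; lia.
Qed.

(** The dimension vectors change by the mutation rule for c-vectors at a green
    vertex. *)
Lemma config_mutation_pos k : pos k ->
  exists (X' : J -> rep K s t) (pos' : J -> bool) (rk' : J -> int),
    config X' pos' rk' /\
    forall j i, signed_dim X' pos' j i =
      if j == k then - beta k i
      else beta j i + Num.max 0 (skew_euler s t (beta k) (beta j)) * beta k i.
Proof.
move=> pk; have [Yb HYb] := fin_all_exists (mutated_exists cfg pk).
exists (fun j => (Yb j).1), (fun j => (Yb j).2).
have [rk' cfg'] := mutated_config cfg pk HYb; exists rk'; split=> // j i.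
rewrite /signed_dim.
case: (HYb j) => [->|Y ne pj [_ d _ _]|Y ne pj [_ d _ _]|Y ne pj [_ d _ _ _]].
- by rewrite eqxx pk.
- rewrite (negbTE ne) skew_same_sign ?pj ?pk // 1?eq_sym // ?pj ?pk /= d.
  have : (ext (X j) (X k) * ext (X k) (X j))%N = 0%N.
    case: (posnP (ext (X j) (X k))) => [->//|gt].
    by rewrite (ext_antisym ne _ gt) ?muln0 // pj.
  case: (posnP (ext (X j) (X k))) => [->|gt]; first by rewrite max_l; lia.
  move=> /eqP; rewrite muln_eq0.
  by move=> /orP[/eqP|/eqP ->]; [lia|rewrite max_r; lia].
- rewrite (negbTE ne) skew_opposite_sign // (negbTE pj) pk /=; have := d i.
  case: (posnP (hom (X j) (X k))) => [->|gt]; first by rewrite max_l; lia.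
  by rewrite (hom_or_ext cfg pk pj gt) max_r; lia.
- rewrite (negbTE ne) skew_opposite_sign // (negbTE pj) pk /=; have := d i.
  case: (posnP (hom (X j) (X k))) => [->|gt]; first by rewrite max_l; lia.
  by rewrite (hom_or_ext cfg pk pj gt) max_r; lia.
Qed.

(** Acyclicity of the red part of L_k for a green [k].  An object [X l] mapping
    injectively to a power of [X k] has no extensions by the other negative
    objects, so nothing forces it above another one, and it can be moved to
    the bottom of the ranking.  If instead [X l] surjects onto [X k], the
    added arrow from [l] to [j] agrees with the old ranks, because an
    extension of [X j] by [X k] lifts to one by [X l]. *)
Lemma two_path_rank k : pos k -> exists rkL : J -> int,
  forall j l, ~~ pos j -> ~~ pos l ->
  (0 < skew_euler s t (beta j) (beta l) -> rkL j < rkL l) /\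
  (0 < skew_euler s t (beta j) (beta k) -> 0 < skew_euler s t (beta k) (beta l) ->
   rkL l < rkL j).
Proof.
move=> pk; have [exc orth perp ord] := cfg.
have [//|bot [_ le_bot]] := @threshold rk pred0 predT.
pose free j := (0 < hom (X j) (X k))%N &&
  [forall l, (~~ pos l && (l != j)) ==> (ext (X j) (X l) == 0%N)].
exists (fun j => if free j then bot - 1 else rk j) => j l nj nl.
have same : pos j = pos l by rewrite (negbTE nj) (negbTE nl).
split.
  case: (eqVneq j l) => [-> |ne].
    rewrite (_ : skew_euler _ _ _ _ = 0) // /skew_euler big1 // => a _.
    by rewrite mulrC subrr.
  rewrite skew_same_sign // => gt0.
  have gt : (0 < ext (X l) (X j))%N by lia.
  have : rk j < rk l by apply: ord gt; rewrite // eq_sym.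
  have -> : free l = false.
    apply/negbTE/negP => /andP[_ /forallP/(_ j)]; rewrite nj ne /= => /eqP; lia.
  by case: ifP => // _; have := le_bot l isT; lia.
have -> : skew_euler s t (beta j) (beta k) = - skew_euler s t (beta k) (beta j).
  by rewrite -sumrN; apply: eq_bigr => a _; ring.
rewrite !skew_opposite_sign // => gtj gtl.
have {}gtj : (0 < ext (X j) (X k))%N by lia.
have {}gtl : (0 < hom (X l) (X k))%N by lia.
have hj0 : hom (X j) (X k) = 0%N.
  by case: (posnP (hom (X j) (X k))) => // /(hom_or_ext cfg pk nj); lia.
have -> : free j = false by rewrite /free hj0.
case: ifP => [_|/negbT]; first by have := le_bot j isT; lia.
have [h e] := perp k l pk nl.
rewrite /free gtl /=; case: (universal_cone (exc k) (exc l) h e) => -[Y].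
  move=> [_ _ contra _] /negP[]; apply/forallP => i; apply/implyP => /andP[ni _].
  have [_ _] := contra (X i); have [_ ->] := perp k i pk ni; lia.
move=> [_ _ _ _ /(_ gtl (X j)) le] _.
have {}gtj : (0 < ext (X j) (X l))%N by lia.
apply: ord gtj => //; apply: contraTneq gtl => <-; by rewrite hj0.
Qed.

End Signs.

Lemma signed_dim_dual (s t : Ar -> I) (X : J -> rep K s t) pos j i :
  signed_dim (fun j => dual (X j)) (fun j => ~~ pos j) j i =
  - signed_dim X pos j i.
Proof. by rewrite /signed_dim /signed /=; case: (pos j); rewrite //= opprK. Qed.

Lemma skew_eulerNN (s t : Ar -> I) (x y x' y' : I -> int) :
    (forall i, x' i = - x i) -> (forall i, y' i = - y i) ->
  skew_euler t s x' y' = skew_euler s t y x.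
Proof.
move=> ex ey; rewrite /skew_euler; apply: eq_bigr => a _; rewrite !ex !ey; ring.
Qed.

Lemma config_mutation_neg (s t : Ar -> I) (X : J -> rep K s t) pos rk k :
    config X pos rk -> ~~ pos k ->
  exists (X' : J -> rep K s t) (pos' : J -> bool) (rk' : J -> int),
    config X' pos' rk' /\
    forall j i, signed_dim X' pos' j i =
      if j == k then - signed_dim X pos k i
      else signed_dim X pos j i + Num.max 0
        (skew_euler s t (signed_dim X pos j) (signed_dim X pos k)) *
        signed_dim X pos k i.
Proof.
move=> /config_dual cfg nk.
have [X' [pos' [rk' [cfg' dX']]]] := config_mutation_pos cfg nk.
exists (fun j => dual (X' j)), (fun j => ~~ pos' j), (fun j => - rk' j).
split=> [|j i]; first exact: config_dual.
rewrite signed_dim_dual dX'.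
rewrite (skew_eulerNN s t (signed_dim_dual X pos k) (signed_dim_dual X pos j)).
by rewrite !signed_dim_dual; case: eqP => _; rewrite ?mulrN ?opprD !opprK.
Qed.

Lemma two_path_rank_neg (s t : Ar -> I) (X : J -> rep K s t) pos rk k :
    config X pos rk -> ~~ pos k ->
  exists rkL : J -> int, forall j l, pos j -> pos l ->
  (0 < skew_euler s t (signed_dim X pos j) (signed_dim X pos l) -> rkL j < rkL l) /\
  (0 < skew_euler s t (signed_dim X pos j) (signed_dim X pos k) ->
   0 < skew_euler s t (signed_dim X pos k) (signed_dim X pos l) -> rkL l < rkL j).
Proof.
move=> /config_dual cfg nk; have [rkL H] := two_path_rank cfg nk.
have skE i l :=
  skew_eulerNN s t (signed_dim_dual X pos i) (signed_dim_dual X pos l).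
exists (fun j => - rkL j) => j l pj pl; have [||H1 H2] := H l j; rewrite ?negbK //.
by rewrite !ltrN2; split; [rewrite -skE | rewrite -!skE => u w; apply: H2].
Qed.

End Configurations.

(** * Acyclicity from ranks *)

Section Acyclicity.
Variable (T : finType).

Lemma acyclic_order (e r : rel T) :
  transitive r -> irreflexive r -> subrel e r -> acyclic e.
Proof.
move=> tr ir sub [//|x p] /= /(sub_path sub)/(order_path_min tr)/allP/(_ x).
by rewrite mem_rcons mem_head ir => /(_ isT).
Qed.

Lemma acyclic_two_blocks (e : rel T) (pos : pred T) (rho : T -> int) :
    (forall u w, e u w -> pos w -> pos u) ->
    (forall u w, e u w -> pos u = pos w -> (rho u < rho w)%R) ->
  acyclic e.
Proof.
move=> epos erho.
apply: (@acyclic_order e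
  [rel u w | if pos u == pos w then (rho u < rho w)%R else pos u]).
- move=> y x z /=; case: (pos x); case: (pos y); case: (pos z) => //=.
  + exact: lt_trans.
  + exact: lt_trans.
- by move=> x /=; rewrite eqxx ltxx.
- move=> u w uw /=; case: eqP => [|ne]; first exact: erho.
  apply: contra_notT ne => nu; rewrite (negbTE nu); apply/esym/negP.
  by move=> /(epos _ _ uw); apply/negP.
Qed.

(** The rank is the number of predecessors of a vertex, itself included. *)
Lemma acyclic_rank (e : rel T) : acyclic e ->
  exists rho : T -> int, forall u w, e u w -> (rho u < rho w)%R.
Proof.
move=> ac; exists (fun u => Posz #|[pred x | connect e x u]|) => u w uw.
rewrite ltz_nat; apply/proper_card/properP; split.
  by apply/subsetP => x; rewrite !inE => xu; apply: connect_trans xu (connect1 uw).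
exists w; rewrite !inE ?connect0 //; apply/negP => /connectP[p pth uE].
suff: cycle e (w :: p) by move/ac.
by rewrite /= rcons_path pth -uE.
Qed.

End Acyclicity.

(** * The simple representations as initial configuration *)

Section Simples.
Local Open Scope ring_scope.
Variables (K : fieldType) (I Ar : finType) (s t : Ar -> I).

Lemma hom_le_dim (X Y : rep K s t) : (hom X Y <= \sum_i rdim X i * rdim Y i)%N.
Proof. by rewrite -(dim_gmap K) -dimvf dimvS ?subvf. Qed.

Lemma exceptional_dim (X : rep K s t) :
  exceptional X -> exists i, (0 < rdim X i)%N.
Proof.
move=> [hX _]; apply/existsP; apply: contra_eqT hX => /existsPn z.
have := hom_le_dim X X; rewrite big1 => [|i _]; first by case: (hom X X).
by have := z i; rewrite lt0n negbK => /eqP ->.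
Qed.

Definition simple_rep (j : I) : rep K s t :=
  @Rep K I Ar s t (fun i => (i == j) : nat) 0.

Lemma sum_eq_mul (j l : I) : (\sum_i (i == j) * (i == l))%N = (j == l) :> nat.
Proof.
by rewrite (bigD1 j) //= eqxx mul1n big1 ?addn0 // => i /negbTE ->.
Qed.

Lemma simple_config (rk : I -> int) : (forall a, rk (t a) < rk (s a)) ->
  config simple_rep (fun _ => true) rk.
Proof.
move=> rk_lt; split=> // [j|j l ne _|j l ne _].
- have := hom_le_dim (simple_rep j) (simple_rep j).
  have := hom_ext_euler (simple_rep j) (simple_rep j).
  rewrite /euler /= sum_eq_mul eqxx big1 => [|a _]; first by split; lia.
  case: eqP => // sa; case: eqP => // ta; have := rk_lt a.
  by rewrite sa ta ltxx.
- have := hom_le_dim (simple_rep j) (simple_rep l).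
  by rewrite /= sum_eq_mul (negbTE ne); lia.
- move=> gt; have := hom_le_dim (simple_rep j) (simple_rep l).
  have := hom_ext_euler (simple_rep j) (simple_rep l).
  rewrite /euler /= sum_eq_mul (negbTE ne).
  case: (pickP [pred a | (s a == j) && (t a == l)]) => [a|none].
    by move=> /andP[/eqP <- /eqP <-].
  rewrite big1 => [|a _]; first by lia.
  by rewrite mulnb; have /= -> := none a.
Qed.

Lemma skew_euler_addl c (x y z : I -> int) :
  skew_euler s t (fun i => x i + c * y i) z =
  skew_euler s t x z + c * skew_euler s t y z.
Proof. by rewrite mulr_sumr -big_split; apply: eq_bigr => a _ /=; ring. Qed.

Lemma skew_eulerV (x y : I -> int) : skew_euler s t x y = - skew_euler s t y x.
Proof. by rewrite -sumrN; apply: eq_bigr => a _; ring. Qed.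

Lemma eq_skew_euler (x x' y y' : I -> int) : x =1 x' -> y =1 y' ->
  skew_euler s t x y = skew_euler s t x' y'.
Proof. by move=> ex ey; apply: eq_bigr => a _; rewrite !ex !ey. Qed.

End Simples.

(** * Seeds of the framed quiver *)

Section ArrowMultiplicities.
Local Open Scope ring_scope.
Variables (n : nat) (V : finType) (v : 'I_n -> V) (v_inj : injective v).

Section Initial.
Variable Q0 : quiver V.

(** The arrows of the mutable part of [Q0], with their direction reversed, so
    that an arrow from [j] to [l] contributes to Ext(S_l, S_j) and the initial
    exchange matrix is the antisymmetrized Euler form. *)
Definition arrow := {p : 'I_n * 'I_n & 'I_(arr Q0 (v p.1) (v p.2))}.
Definition asrc (a : arrow) : 'I_n := (tag a).2.
Definition atgt (a : arrow) : 'I_n := (tag a).1.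

Definition net (Q : quiver (V + 'I_n)%type) (j l : 'I_n) : int :=
  (arr Q (inl (v j)) (inl (v l)))%:Z - (arr Q (inl (v l)) (inl (v j)))%:Z.

Lemma sum_arrows (j l : 'I_n) :
  \sum_(a : arrow) ((atgt a == j) * (asrc a == l))%N%:Z = (arr Q0 (v j) (v l))%:Z.
Proof.
transitivity (\sum_(p : 'I_n * 'I_n) \sum_(r < arr Q0 (v p.1) (v p.2))
    ((p.1 == j) * (p.2 == l))%N%:Z).
  by rewrite sig_big_dep.
rewrite (bigD1 (j, l)) //= [X in _ + X]big1 => [|p ne].
  rewrite addr0 !eqxx sumr_const card_ord.
  by rewrite -mulr_natr mul1r natz.
rewrite big1 // => r _; case: eqP => // e1; case: eqP => // e2.
by move: ne; rewrite -e1 -e2 -surjective_pairing eqxx.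
Qed.

(** The invariant of the mutation class: the c-vectors are the signed dimension
    vectors of a configuration, and its antisymmetrized Euler form is the
    exchange matrix. *)
Definition seed_of (Q : quiver (V + 'I_n)%type) : Prop :=
  exists (X : 'I_n -> rep rat asrc atgt) pos rk,
  [/\ config X pos rk, forall i j, cmx v Q i j = signed_dim X pos j i &
      forall j l, net Q j l =
        skew_euler asrc atgt (signed_dim X pos j) (signed_dim X pos l)].

Lemma seed_framing : acyclic (edge Q0) -> seed_of (framing v Q0).
Proof.
move=> /acyclic_rank[rho rho_lt].
exists (@simple_rep rat _ _ asrc atgt), (fun _ => true), (fun i => rho (v i)).
split.
- apply: simple_config => -[p r]; apply: rho_lt.
  exact: leq_ltn_trans (ltn_ord r).
- move=> i j; rewrite /cmx /arr !ffunE /signed_dim /= subr0 (inj_eq v_inj).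
  by rewrite eq_sym.
- move=> j l; rewrite /net /arr !ffunE -/(arr _ _ _) -/(arr _ _ _).
  rewrite -!sum_arrows -sumrB.
  apply: eq_bigr => a _; rewrite /signed_dim /= !PoszM; ring.
Qed.

Lemma max_short (x y : nat) :
  x = 0%N \/ y = 0%N -> Num.max 0 (x%:Z - y%:Z) = x%:Z.
Proof. by case=> ->; [rewrite max_l|rewrite max_r]; lia. Qed.

Lemma net_pos (Q : quiver (V + 'I_n)%type) j l :
  Num.max 0 (net Q j l) = (arr Q (inl (v j)) (inl (v l)))%:Z.
Proof. exact/max_short/arr_short. Qed.

Lemma net_gt0 (Q : quiver (V + 'I_n)%type) j l :
  (0 < net Q j l) = (0 < arr (mutable_part v Q) j l)%N.
Proof.
rewrite [in RHS]/arr ffunE /net /=.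
case: (arr_short Q (inl (v j)) (inl (v l))) => ->; first by lia.
by rewrite subr0 ltz_nat.
Qed.

Lemma seed_mutate (Q : quiver (V + 'I_n)%type) k :
  seed_of Q -> seed_of (mutate (inl (v k)) Q).
Proof.
move=> [X [pos [rk [cfg cE netE]]]].
have inlE u w : (inl (v u) == inl (v w) :> V + 'I_n) = (u == w).
  by apply/eqP/eqP => [[/v_inj]|->].
have inrE i u : (inr i == inl u :> V + 'I_n) = false by [].
have arrE u w : arr (mutate (inl (v k)) Q) (inl (v u)) (inl (v w)) =
   if (u == k) || (w == k) then arr Q (inl (v w)) (inl (v u)) else
   ((arr Q (inl (v u)) (inl (v w)) +
      arr Q (inl (v u)) (inl (v k)) * arr Q (inl (v k)) (inl (v w))) -
    (arr Q (inl (v w)) (inl (v u)) +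
      arr Q (inl (v w)) (inl (v k)) * arr Q (inl (v k)) (inl (v u))))%N.
  by rewrite arr_mutate !inlE.
pose d j := (if pos k then arr Q (inl (v k)) (inl (v j))
             else arr Q (inl (v j)) (inl (v k)))%:Z.
have [X' [pos' [rk' [cfg' dX']]]] :
    exists (X' : 'I_n -> rep rat asrc atgt) pos' rk',
    config X' pos' rk' /\
    forall j i, signed_dim X' pos' j i =
      if j == k then - signed_dim X pos k i
      else signed_dim X pos j i + d j * signed_dim X pos k i.
  rewrite /d; case pk: (pos k).
    have [X' [pos' [rk' [cfg' dX']]]] := config_mutation_pos cfg pk.
    by exists X', pos', rk'; split=> // j i; rewrite dX' -netE net_pos.
  have [X' [pos' [rk' [cfg' dX']]]] := config_mutation_neg cfg (negbT pk).
  by exists X', pos', rk'; split=> // j i; rewrite dX' -netE net_pos.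
exists X', pos', rk'; split=> // [i j|j l].
  rewrite dX' -!cE /cmx !arr_mutate !inlE !inrE orbF /=.
  case: (eqVneq j k) => [->|_] /=; rewrite ?eqxx; first by lia.
  have := cE i k; rewrite /d /cmx /signed_dim /signed.
  have := arr_short Q (inr i) (inl (v j)).
  have := arr_short Q (inl (v j)) (inl (v k)).
  have := arr_short Q (inr i) (inl (v k)).
  move: (arr Q (inr i) (inl (v k))) (arr Q (inl (v k)) (inr i)) => ik ki.
  move: (arr Q (inr i) (inl (v j))) (arr Q (inl (v j)) (inr i)) => ij ji.
  move: (arr Q (inl (v j)) (inl (v k))) (arr Q (inl (v k)) (inl (v j))).
  move=> jk kj; by case: (pos k) => -[]-> [] -> [] ->; nia.
(* the coefficient -2 turns the vector of k into its opposite, so that all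
   vectors change by a multiple of the vector of k *)
pose c i := if i == k then -2 else d i.
have dX'' i : signed_dim X' pos' i =1
    (fun h => signed_dim X pos i h + c i * signed_dim X pos k h).
  by move=> h; rewrite dX' /c; case: eqP => [->|//]; ring.
rewrite (eq_skew_euler _ _ (dX'' j) (dX'' l)) skew_euler_addl.
rewrite [skew_euler _ _ (signed_dim X pos j) _]skew_eulerV.
rewrite [skew_euler _ _ (signed_dim X pos k) _]skew_eulerV !skew_euler_addl.
rewrite -!netE /net !arrE /c /d.
case: (eqVneq j k) => [->|nj]; case: (eqVneq l k) => [->|nl] /=; try lia.
have := arr_short Q (inl (v j)) (inl (v l)).
have := arr_short Q (inl (v j)) (inl (v k)).
have := arr_short Q (inl (v l)) (inl (v k)).
have := arr_short Q (inl (v k)) (inl (v k)).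
move: (arr Q (inl (v l)) (inl (v k))) (arr Q (inl (v k)) (inl (v l))).
move=> lk kl.
move: (arr Q (inl (v j)) (inl (v l))) (arr Q (inl (v l)) (inl (v j))).
move=> jl lj.
move: (arr Q (inl (v j)) (inl (v k))) (arr Q (inl (v k)) (inl (v j))).
move=> jk kj.
move: (arr Q (inl (v k)) (inl (v k))) => kk.
by case: (pos k) => -[]-> [] -> [] -> [] ->;
  rewrite ?muln0 ?mul0n ?addn0 ?add0n; nia.
Qed.

End Initial.

Lemma seed_tree (Q0 : quiver V) tQ : acyclic (edge Q0) ->
  mutation_assignment v Q0 tQ -> forall t : tree n, seed_of Q0 (tQ t).
Proof.
move=> ac [root step] [w]; elim: w => [|k w IHw] w_red.
  rewrite (_ : exist _ _ _ = tree_root n); last exact: val_inj.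
  by rewrite root; apply: seed_framing.
have w_red' : sorted [rel i j | i != j] w by apply: path_sorted w_red.
rewrite (step k _ (exist _ w w_red')); last by left.
exact: seed_mutate.
Qed.

End ArrowMultiplicities.

Theorem lemma5p5 (n : nat) (V : finType) (v : 'I_n -> V) (v_inj : injective v)
    (Q0 : quiver V) (Q0_acyclic : acyclic (edge Q0))
    (tQ : tree n -> quiver (V + 'I_n)%type)
    (tQ_assign : mutation_assignment v Q0 tQ) (t : tree n) :
  let Qt := mutable_part v (tQ t) in
  let is_green := green v (tQ t) in
  let is_red := red v (tQ t) in
  (forall j : 'I_n,
     let L := L_graph Qt is_green is_red j in
     acyclic (marked_edge L) /\
     (forall u w : 'I_n, ~~ (marked_edge L u w && marked_edge L w u))) /\
  acyclic (induced_edge Qt is_red) /\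
  acyclic (induced_edge Qt is_green).
Proof.
move=> Qt is_green is_red.
have [X [pos [rk [cfg cE netE]]]] := seed_tree v_inj Q0_acyclic tQ_assign t.
have greenE j : is_green j = pos j.
  have [i Xi] := exceptional_dim (config_exc cfg j).
  rewrite /is_green /green /=; case pj: (pos j).
    by apply/forallP => h; rewrite cE /signed_dim pj.
  by apply/negbTE/forallPn; exists i; rewrite cE /signed_dim pj /=; lia.
have redE j : is_red j = ~~ pos j.
  have [i Xi] := exceptional_dim (config_exc cfg j).
  rewrite /is_red /red /=; case pj: (pos j) => /=.
    by apply/negbTE/forallPn; exists i; rewrite cE /signed_dim pj /=; lia.
  by apply/forallP => h; rewrite cE /signed_dim pj /=; lia.
have edgeE j l : (0 < arr Qt j l)%N -> (0 < net v (tQ t) j l)%R.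
  by rewrite net_gt0.
have edge_rk j l : pos j = pos l -> (0 < arr Qt j l)%N -> (rk j < rk l)%R.
  move=> e gt; have ne : j != l.
    by apply: contraTneq gt => ->; case: (arr_short Qt l l) => ->.
  have := edgeE _ _ gt; rewrite netE (skew_same_sign cfg ne e) => lt.
  by apply: (config_rk cfg); rewrite 1?eq_sym //; lia.
split; last first.
  split; apply: (acyclic_two_blocks (pos := xpredT) (rho := rk)) => // j l;
    move=> /and3P[].
    by rewrite !redE => /negbTE pj /negbTE pl gt _; apply: edge_rk; rewrite ?pj.
  by rewrite !greenE => pj pl gt _; apply: edge_rk; rewrite ?pj.
move=> k L.
(* the added arrows lie in the colour opposite to that of k; the other colour
   keeps the ranks of the configuration *)
have [rho rhoE] : exists rho : 'I_n -> int, forall j l, pos j = pos l ->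
    ((0 < arr Qt j l)%N -> (rho j < rho l)%R) /\
    (pos j != pos k -> (0 < arr Qt j k)%N -> (0 < arr Qt k l)%N ->
     (rho l < rho j)%R).
  case pk: (pos k).
    have [rkL H] := two_path_rank cfg pk.
    exists (fun j => if pos j then rk j else rkL j) => j l e; rewrite -e.
    case pj: (pos j) => /=; first by split=> //; apply: edge_rk.
    have [||H1 H2] := H j l; rewrite -?e ?pj //.
    split=> [/edgeE|_ /edgeE + /edgeE]; rewrite !netE; [exact: H1 | exact: H2].
  have [rkL H] := two_path_rank_neg cfg (negbT pk).
  exists (fun j => if pos j then rkL j else rk j) => j l e; rewrite -e.
  case pj: (pos j) => /=; last by split=> //; apply: edge_rk.
  have [||H1 H2] := H j l; rewrite -?e ?pj //.
  split=> [/edgeE|_ /edgeE + /edgeE]; rewrite !netE; [exact: H1 | exact: H2].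
have Ledge u w : marked_edge L u w ->
    (pos w -> pos u) /\ (pos u = pos w -> (rho u < rho w)%R).
  move=> /existsP[o]; rewrite /L /L_graph /reverse_red_green !redE !greenE.
  case: o => [x|]; rewrite /= ?redE ?greenE.
    case pu: (pos u); case pw: (pos w) => //=;
      rewrite !(andbF, andbT, orbF, addn0).
      case: ifP => // /andP[_ nk]; rewrite muln_gt0 => /andP[wk ku]; split=> // _.
      by apply: (rhoE w u _).2; rewrite ?pu ?pw ?(negbTE nk).
    case: ifP => // /andP[_ /= pk]; rewrite muln_gt0 => /andP[wk ku]; split=> // _.
    by apply: (rhoE w u _).2; rewrite ?pu ?pw ?pk.
  case pu: (pos u); case pw: (pos w) => //=; rewrite addn0 => uw; split=> // _.
    by apply: (rhoE u w _).1; rewrite ?pu ?pw.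
  by apply: (rhoE u w _).1; rewrite ?pu ?pw.
have Lac : acyclic (marked_edge L).
  by apply: (acyclic_two_blocks (pos := pos) (rho := rho)) => u w /Ledge[].
split=> // u w; apply/negP => /andP[uw wu].
suff : cycle (marked_edge L) [:: u; w] by move/Lac.
by rewrite /= uw wu.
Qed.
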